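(* The number of shortest path trees of $\overline G_n$ from vertex $1$ satisfies \[\log\#\{\text{shortest path trees of }\overline G_n\}=n\Psi_0(\lambda_n)+\lambda_n n\log\big(\alpha_n(1-\lambda_n)\log n\big)+o_p(n).\] In particular, if $\lambda_n\to\lambda\in[0,1]$ and $\Delta_n\to\Delta\in[0,1]$, then \[\frac{\log\#\{\text{shortest path trees of }\overline G_n\}}{n\log\log n}\to\lambda+\Delta=\begin{cases}\Delta&\text{if }0<\Delta\le1,\\ \lambda&\text{if }\Delta=0\end{cases}\] in probability.
   Context: Let $(\alpha_n)$ be a sequence in $(0,\infty)$ with $0<\liminf\alpha_n\le\limsup\alpha_n<\infty$, $q_n=\alpha_n\log n/n$, $G_n\sim\mathcal G(n,q_n)$ on $\{1,\dots,n\}$, $\ell_n^*=\log n/\log(nq_n)$, $d_n^*=\min\{d\in\mathbb Z:(nq_n)^d\ge n/(\log\log n)^2\}$, $\Delta_n=d_n^*-\ell_n^*$, $\lambda_n\in(0,1)$ with $\log(1/\lambda_n)=(nq_n)^{d_n^*}/n$. $\overline G_n$ is the component of $G_n$ containing $1$; a shortest path tree is a spanning tree $T$ of $\overline G_n$ with $\mathsf d_T(1,v)=\mathsf d_{G_n}(1,v)$ for all vertices $v$. $\Psi_0(\lambda)=\mathbb E[\log(X\vee1)]$ with $X\sim\mathrm{Poisson}(\log(1/\lambda))$. $Y_n=o_p(n)$ means $Y_n/n\to0$ in probability. *)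

(* Defs.v *)
From HB Require Import structures.
From mathcomp Require Export all_boot all_order all_algebra.
From mathcomp Require Export all_classical all_reals all_analysis.
Set Implicit Arguments.
Unset Strict Implicit.
Unset Printing Implicit Defensive.
Import Order.TTheory GRing.Theory Num.Theory.
Import numFieldNormedType.Exports.
Local Open Scope classical_set_scope.
Local Open Scope ring_scope.

(* A simple graph on T is identified with its edge set, a set of two-element
   subsets of T, i.e. a subset of all_edges T. *)
Notation edge_set T := {set {set T}}.

Section Graphs.
Variable T : finType.
Implicit Types (G F : edge_set T) (V : {set T}) (r u v : T).

Definition all_edges : edge_set T := [set e : {set T} | #|e| == 2].

Definition adj G : rel T := [rel u v | (u != v) && ([set u; v]%SET \in G)].

Definition walk G (k : nat) u v : bool :=
  [exists p : k.-tuple T, path (adj G) u p && (last u p == v)].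

(* Least length of a walk from u to v; the value #|T|, which is larger than
   every finite distance, stands for an infinite distance. *)
Definition gdist G u v : nat := find (fun k => walk G k u v) (iota 0 #|T|).

Definition comp_verts G r : {set T} := [set v | connect (adj G) r v].

Definition comp_edges G r : edge_set T :=
  [set e in G | e \subset comp_verts G r].

(* The closed sequences of length 2 accepted by ucycle traverse a single edge
   back and forth, so only those of length at least 3 are cycles. *)
Definition acyclic F : Prop :=
  forall c : seq T, ucycle (adj F) c -> (size c <= 2)%N.

Definition is_tree V F : Prop :=
  [/\ forall e, e \in F -> e \subset V,
      forall u v, u \in V -> v \in V -> connect (adj F) u v
    & acyclic F].

Definition spanning_tree_of_comp G r F : Prop :=
  F \subset comp_edges G r /\ is_tree (comp_verts G r) F.

Definition shortest_path_tree G r F : Prop :=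
  spanning_tree_of_comp G r F /\
  forall v, v \in comp_verts G r -> gdist F r v = gdist G r v.

Definition num_spt G r : nat :=
  #|[set F : edge_set T | `[< shortest_path_tree G r F >] ]%SET|.

End Graphs.

Arguments all_edges : clear implicits.

(* The vertex set {1, ..., n}: ord0 is the vertex 1, and ordinal i is the
   vertex i + 1. The shape n.-1.+1 (= n for n > 0) makes ord0 available for a
   variable n; the index n = 0 is meaningless and irrelevant to the limits. *)
Notation vertex n := ('I_n.-1.+1).

Section ErdosRenyi.
Variable R : realType.

Definition er_mass (n : nat) (p : R) (G : edge_set (vertex n)) : R :=
  \prod_(e in all_edges (vertex n)) (if e \in G then p else 1 - p).

(* Probability that a G(n, p) random graph satisfies A, for 0 <= p <= 1. *)
Definition er_prob (n : nat) (p : R) (A : pred (edge_set (vertex n))) : R :=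
  \sum_(G in powerset (all_edges (vertex n)) | A G) er_mass p G.

(* Convergence in probability to the constant l of Y_n(G_n) when
   G_n ~ G(n, p_n). The law of G_n suffices: the G_n need not be defined on a
   common probability space. *)
Definition er_cvg_in_prob (p : nat -> R)
    (Y : forall n : nat, edge_set (vertex n) -> R) (l : R) : Prop :=
  forall eps : R, 0 < eps ->
    er_prob (p n) [pred G | eps < `|Y n G - l|] @[n --> \oo] --> (0 : R).

(* Y_n = o_p(n). *)
Definition er_little_op_n (p : nat -> R)
    (Y : forall n : nat, edge_set (vertex n) -> R) : Prop :=
  er_cvg_in_prob p (fun n G => Y n G / n%:R) 0.

End ErdosRenyi.

Section Sequences.
Variables (R : realType) (alpha : nat -> R).

(* q_n lies in [0, 1] for all large n, since alpha is bounded. *)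
Definition edge_prob (n : nat) : R := alpha n * ln n%:R / n%:R.

Definition mean_deg (n : nat) : R := n%:R * edge_prob n.

Definition ell_star (n : nat) : R := ln n%:R / ln (mean_deg n).

(* The minimum exists as soon as mean_deg n > 1 and ln (ln n) > 0, hence for
   all large n; otherwise the value may be the default 0. *)
Definition d_star (n : nat) : int :=
  let S := [set d : int | n%:R / ln (ln n%:R) ^+ 2 <= mean_deg n ^ d] in
  xget 0 [set d : int | S d /\ forall d' : int, S d' -> d <= d'].

Definition Delta (n : nat) : R := (d_star n)%:~R - ell_star n.

(* The solution of ln (1 / lambda n) = mean_deg n ^ d_star n / n. *)
Definition lambda (n : nat) : R := expR (- (mean_deg n ^ d_star n / n%:R)).

End Sequences.

(* The second argument of poisson_prob is unused in its definition. *)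
Definition Psi0 (R : realType) (lam : R) : R :=
  fine ('E_(poisson_prob (ln (1 / lam)) 0%N)
          [(fun k : nat => ln (maxn k 1)%:R)]).

(* Main.v *)
(* A shortest path tree amounts to the choice, for every vertex v <> 1 of the
   component, of a parent among the neighbours of v one step closer to 1; hence
   log #trees is the sum over v of the logarithm of the number of such
   neighbours.  Put D = n q_n and k = d* - 1.  Breadth-first search reveals the
   graph sphere by sphere; second moments show that the sphere of radius k has
   size about D^k = o(n), so that the ball of radius k is negligible.  Given that
   sphere, a vertex outside the ball has a Binomial(D^k, q_n), hence almost
   Poisson(log (1 / lambda)), number of neighbours in it: these vertices
   contribute n Psi0(lambda), and n (1 - lambda) of them form the next sphere.
   Each of the remaining lambda n vertices has about D (1 - lambda) neighbours in
   that sphere, which gives the second term.  Vertices farther away are too few to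
   matter.  All errors are controlled by Chebyshev at the scale
   u = (log log n)^(-1/2). *)

Require Import Defs.
From mathcomp Require Import measurable_realfun ring lra.
Set Implicit Arguments.
Unset Strict Implicit.
Unset Printing Implicit Defensive.
Import Order.TTheory GRing.Theory Num.Theory.
Import numFieldNormedType.Exports.

(** * Walks, graph distance, and neighbours one step closer to the root *)

Section GraphDistance.
Variable T : finType.
Implicit Types (G F : edge_set T) (r u v w : T).

(** The probabilistic core is a statement at fixed size with explicit constants: outside an event of
    probability at most [13 u], the error is at most [45 u n]. Limits are taken only afterwards. The
    exponents of [u] come from the size of the logarithms. A vertex may weigh about [ln D], which is
    at most [2 / u^2], so sets of vertices are controlled up to a proportion [u^3] in order to cost
    only order [u n]. The threshold in [d_star] is [u^4 n]. As an upper bound on [D^k] it makes the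
    ball of radius [k] negligible even after this weighting. As a lower bound on [D^(k+1)] it gives
    [1 - lambda >= u^4 / 2], so the typical number of parents in the second layer is still large
    when [1 - lambda] tends to 0. That possibility is also why the size of the next sphere is
    estimated with relative errors. Since the sphere of radius [k] has random size, the binomial
    mean of the logarithm is compared between two numbers of trials before it is compared with its
    Poisson limit. *)

Lemma adj_sym G : symmetric (adj G).
Proof. by move=> u v; rewrite /adj /= eq_sym finset.setUC. Qed.

Lemma connect_adj_sym G : connect_sym (adj G).
Proof. exact/sym_connect_sym/adj_sym. Qed.

Lemma adj_sub G F : F \subset G -> subrel (adj F) (adj G).
Proof. by move=> /fintype.subsetP sFG u v /andP[uv /sFG]; rewrite /adj /= uv. Qed.

Lemma walkP G k u v :
  reflect (exists p, [/\ size p = k, path (adj G) u p & last u p = v])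
          (walk G k u v).
Proof.
apply: (iffP existsP) => [[p /andP[up /eqP pv]]|[p [sp up pv]]].
  by exists p; rewrite size_tuple.
by move/eqP: sp => sp; exists (Tuple sp); rewrite /= up pv eqxx.
Qed.

Lemma walk0 G u v : walk G 0 u v = (u == v).
Proof.
apply/walkP/eqP => [[p [/size0nil -> _ /=]] //|->].
by exists [::].
Qed.

Lemma walkSP G k u v :
  reflect (exists2 w, walk G k u w & adj G w v) (walk G k.+1 u v).
Proof.
apply: (iffP (walkP _ _ _ _)) => [[p [sp up pv]]|[w /walkP[p [sp up pw]] wv]].
  case/lastP: p sp up pv => // p x; rewrite size_rcons rcons_path last_rcons.
  move=> [sp] /andP[up px] <-; exists (last u p) => //.
  by apply/walkP; exists p.
by exists (rcons p v); rewrite size_rcons rcons_path last_rcons up sp pw wv.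
Qed.

Lemma walk_sub G F k u v : F \subset G -> walk F k u v -> walk G k u v.
Proof.
move=> sFG /walkP[p [sp up pv]]; apply/walkP; exists p; split=> //.
exact: sub_path (adj_sub sFG) _ _ up.
Qed.

Lemma walk_connect G k u v : walk G k u v -> connect (adj G) u v.
Proof. by move=> /walkP[p [_ up pv]]; apply/connectP; exists p. Qed.

Lemma gdist_min G k u v : walk G k u v -> gdist G u v <= k.
Proof.
move=> uv; rewrite leqNgt; apply/negP => ltk.
have := before_find 0 ltk; rewrite nth_iota ?uv //.
by apply: leq_trans ltk _; rewrite (leq_trans (find_size _ _)) ?size_iota.
Qed.

Lemma gdist_walk G u v : connect (adj G) u v -> walk G (gdist G u v) u v.
Proof.
move=> /connectP[p up ->]; case/shortenP: up => p' up' Up' _ {p}.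
have ltp : size p' < #|T|.
  by rewrite -[(size p').+1]/(size (u :: p')) -(card_uniqP Up') max_card.
have has_w : has (fun k => walk G k u (last u p')) (iota 0 #|T|).
  apply/hasP; exists (size p'); rewrite ?mem_iota //.
  by apply/walkP; exists p'.
have := nth_find 0 has_w; rewrite nth_iota ?add0n //.
by rewrite has_find size_iota in has_w.
Qed.

Lemma gdistxx G u : gdist G u u = 0.
Proof. by apply/eqP; rewrite -leqn0; apply: gdist_min; rewrite walk0. Qed.

Lemma gdist_eq0 G u v : connect (adj G) u v -> gdist G u v = 0 -> u = v.
Proof. by move=> /gdist_walk + e; rewrite e walk0 => /eqP. Qed.

Lemma gdist_adj G r u v : connect (adj G) r u -> adj G u v ->
  gdist G r v <= (gdist G r u).+1.
Proof.
by move=> /gdist_walk ru uv; apply: gdist_min; apply/walkSP; exists u.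
Qed.

Definition preds G r v : {set T} :=
  [set u | adj G u v & (gdist G r u).+1 == gdist G r v].

(** The subgraph [F] is [G] itself when predecessors are shown to exist, and a given shortest path
    tree when its parent function is extracted. *)
Lemma gdist_pred G F r v : F \subset G -> connect (adj G) r v ->
  walk F (gdist G r v) r v -> v != r ->
  exists2 u, adj F u v & u \in preds G r v.
Proof.
move=> sFG rv; case E: (gdist G r v) => [|d]; first by rewrite walk0 eq_sym => ->.
move=> /walkSP[u ru uv] _; exists u => //; rewrite inE (adj_sub sFG uv) /=.
have cu : connect (adj G) r u by apply: walk_connect (walk_sub sFG ru).
rewrite E eqSS eqn_leq (gdist_min (walk_sub sFG ru)) /=.
by have := gdist_adj cu (adj_sub sFG uv); rewrite E.
Qed.

Lemma preds_neq0 G r v : connect (adj G) r v -> v != r ->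
  0 < #|preds G r v|.
Proof.
move=> rv vr; have [u _ pu] := gdist_pred (subxx G) rv (gdist_walk rv) vr.
by apply/card_gt0P; exists u.
Qed.

Lemma preds_connect G r u v : connect (adj G) r v -> u \in preds G r v ->
  connect (adj G) r u.
Proof.
move=> rv; rewrite inE => /andP[uv _].
by apply: connect_trans rv _; apply: connect1; rewrite adj_sym.
Qed.

End GraphDistance.

(** * Shortest path trees as parent functions *)

Section ParentFunctions.
Variables (T : finType) (G : edge_set T) (r : T).
Implicit Types (F : edge_set T) (u v w : T) (f : {ffun T -> T}).

Let C := comp_verts G r.
Let d v := gdist G r v.

(** The singleton at the root and off the component leaves no choice there, so [family parents] is
    in bijection with the trees and its cardinal is a product over all vertices. *)
Definition parents v : {set T} :=
  if v \in C :\ r then preds G r v else [set v].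

Definition parent_tree f : edge_set T := [set [set v; f v] | v in C :\ r].

Lemma parentsP f v : f \in family parents -> v \in C :\ r ->
  [/\ adj G (f v) v, (d (f v)).+1 = d v & f v \in C].
Proof.
move=> /familyP/(_ v); rewrite /parents => + vC; rewrite vC => fv.
move: vC; rewrite !inE => /andP[vr rv]; move: (fv); rewrite inE.
by move=> /andP[? /eqP ?]; split=> //; apply: preds_connect fv.
Qed.

Lemma adj_parent_tree f x y : adj (parent_tree f) x y ->
  (x \in C :\ r /\ y = f x) \/ (y \in C :\ r /\ x = f y).
Proof.
move=> /andP[xy /imsetP[v vC E]].
have : x \in [set v; f v] by rewrite -E !inE eqxx.
have : y \in [set v; f v] by rewrite -E !inE eqxx orbT.
move=> /set2P[yE|yE] /set2P[xE|xE].
- by rewrite xE yE eqxx in xy.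
- by right; rewrite yE xE.
- by left; rewrite yE xE.
- by rewrite xE yE eqxx in xy.
Qed.

Lemma parent_tree_adj f v : f \in family parents -> v \in C :\ r ->
  adj (parent_tree f) (f v) v.
Proof.
move=> fP vC; have [/andP[fv _] _ _] := parentsP fP vC.
by rewrite /adj /= fv finset.setUC /=; apply/imsetP; exists v.
Qed.

Lemma parent_tree_sub f : f \in family parents -> parent_tree f \subset G.
Proof.
move=> fP; apply/fintype.subsetP => e /imsetP[v vC ->].
by have [/andP[_ ?] _ _] := parentsP fP vC; rewrite finset.setUC.
Qed.

Lemma parent_tree_walk f v : f \in family parents -> v \in C ->
  walk (parent_tree f) (d v) r v.
Proof.
move=> fP; move E: (d v) => k; elim: k v E => [|k IH] v E vC.
  by rewrite walk0; apply/eqP/(gdist_eq0 _ E); rewrite inE in vC.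
have vr : v != r by apply/eqP => vr; rewrite /d vr gdistxx in E.
have vC' : v \in C :\ r by rewrite finset.in_setD1 vr.
have [_ fv fC] := parentsP fP vC'; rewrite E in fv; case: fv => fv.
by apply/walkSP; exists (f v); [exact: IH|exact: parent_tree_adj].
Qed.

(** On a cycle, take a vertex at maximal distance from [r]. Neither of its two cyclic neighbours can
    be its child, so both are its parent, which is impossible in a cycle of length at least 3. *)
Lemma parent_tree_acyclic f : f \in family parents -> acyclic (parent_tree f).
Proof.
move=> fP c /andP[cc Uc]; rewrite leqNgt; apply/negP => c3.
case: c cc Uc c3 => // x0 c' cc Uc c3; set c := x0 :: c' in cc Uc c3.
have x0c : x0 \in c by rewrite mem_head.
pose x := [arg max_(i > x0 | i \in c) d i].
have [xc xmax] : x \in c /\ forall j, j \in c -> d j <= d x.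
  by rewrite /x; case: arg_maxnP.
have nb y : y \in c -> adj (parent_tree f) x y -> y = f x.
  move=> yc /adj_parent_tree[[] //|[yC xE]].
  have [_ + _] := parentsP fP yC; rewrite -xE => dy.
  by have := xmax _ yc; rewrite -dy ltnn.
have ne : next c x = f x by apply: nb; [rewrite mem_next|exact: next_cycle].
have pe : prev c x = f x.
  by apply: nb; [rewrite mem_prev|rewrite adj_sym; exact: prev_cycle].
have [i p Ep] := rot_to xc.
have Up : uniq (x :: p) by rewrite -Ep rot_uniq.
have sp : size (x :: p) > 2 by rewrite -Ep size_rot.
have := ne; rewrite -(next_rot i Uc) Ep.
have := pe; rewrite -(prev_rot i Uc) Ep.
case: p Up sp {Ep} => [|y [|z p]] //= /and3P[]; rewrite !inE !negb_or.
move=> /and3P[xy xz xp] /andP[yz yp] _ _; rewrite !eqxx.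
(* With the cycle rotated to start at [x], the successor of [x] is [y], while its predecessor is the
   last element, which lies in [z :: p] and so differs from [y]. *)
move=> prevE nextE; have : prev [:: x, y, z & p] x \in z :: p.
  rewrite prev_nth mem_head memNindex; last by rewrite !inE !negb_or xy xz.
  by rewrite -[nth _ _ _]/(nth x (z :: p) (size p)) mem_nth.
by rewrite /= prevE -nextE inE (negPf yz) (negPf yp).
Qed.

Lemma parent_tree_spt f : f \in family parents ->
  shortest_path_tree G r (parent_tree f).
Proof.
move=> fP; have con v : v \in C -> connect (adj (parent_tree f)) r v.
  by move=> /(parent_tree_walk fP)/walk_connect.
have sub v : v \in C :\ r -> [set v; f v] \subset C.
  move=> vC; have [_ _ fC] := parentsP fP vC.
  by apply/fintype.subsetP => z /set2P[] -> //; move: vC; rewrite finset.in_setD1 => /andP[].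
split; [split; [|split]|].
- apply/fintype.subsetP => e eF; rewrite inE (fintype.subsetP (parent_tree_sub fP)) //=.
  by case/imsetP: eF => v vC ->; exact: sub.
- by move=> e /imsetP[v vC ->]; exact: sub.
- move=> u v uC vC; apply: connect_trans (con _ vC).
  by rewrite connect_adj_sym con.
- exact: parent_tree_acyclic.
move=> v vC; apply/eqP; rewrite eqn_leq; apply/andP; split.
  exact/gdist_min/parent_tree_walk.
by apply/gdist_min/(walk_sub (parent_tree_sub fP))/gdist_walk/con.
Qed.

(** An edge oriented oppositely by [f] and [g] would have each endpoint one step farther from the
    root than the other. *)
Lemma parent_tree_inj : {in family parents &, injective parent_tree}.
Proof.
move=> f g fP gP E; apply/ffunP => v.
case: (boolP (v \in C :\ r)) => vC; last first.
  move: fP gP => /familyP/(_ v) + /familyP/(_ v).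
  by rewrite /parents (negPf vC) !inE => /eqP -> /eqP ->.
have [_ dg _] := parentsP gP vC.
have := parent_tree_adj gP vC; rewrite -E => /adj_parent_tree[[gC vE]|[_ ->//]].
have [_ + _] := parentsP fP gC; rewrite -vE => df.
by move: dg; rewrite -df => /eqP; rewrite -addn2 -[X in _ == X]addn0 eqn_add2l.
Qed.

(** An edge of [F] missing from [F'] would close a simple path of [F'] between its endpoints into a
    cycle of [F]. *)
Lemma acyclic_connected_sub (F F' : edge_set T) (V : {set T}) :
  F' \subset F -> F \subset all_edges T -> is_tree V F ->
  (forall u v, u \in V -> v \in V -> connect (adj F') u v) -> F = F'.
Proof.
move=> sF F2 [FV _ acF] con; apply/eqP; rewrite finset.eqEsubset sF andbT.
apply/fintype.subsetP => e eF; apply/negPn/negP => eF'.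
have /FV eV := eF; have := fintype.subsetP F2 _ eF; rewrite inE => /cards2P[x [y [xy eE]]].
have /con : x \in V by apply: (fintype.subsetP eV); rewrite eE !inE eqxx.
have yV : y \in V by apply: (fintype.subsetP eV); rewrite eE !inE eqxx orbT.
move=> /(_ _ yV) /connectP[p xp yE].
case/shortenP: xp yE => {}p xp Up _ yE.
have : ucycle (adj F) (x :: p).
  rewrite /ucycle Up andbT /= rcons_path (sub_path (adj_sub sF) xp) /= -yE.
  by rewrite /adj /= eq_sym xy finset.setUC -eE.
move/acF; case: p xp yE {Up} => [|z [|w p]] //=.
  by move=> _ yE; rewrite yE eqxx in xy.
by rewrite andbT => /andP[_ xz] yE _; rewrite eE yE xz in eF'.
Qed.

(** Choosing every parent along an edge of [F] gives a tree inside [F] that already connects the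
    component, hence exhausts [F]. *)
Lemma spt_parent_tree F : G \subset all_edges T -> shortest_path_tree G r F ->
  exists2 f, f \in family parents & F = parent_tree f.
Proof.
move=> G2 [[FG treeF] dF].
have sFG : F \subset G.
  by apply: fintype.subset_trans FG _; apply/fintype.subsetP => e; rewrite inE => /andP[].
have rC : r \in C by rewrite inE connect0.
have [FV con _] := treeF.
have ex v : v \in C :\ r -> exists2 u, adj F u v & u \in preds G r v.
  rewrite finset.in_setD1 => /andP[vr vC]; apply: gdist_pred => //.
    by rewrite inE in vC.
  by rewrite -dF //; apply/gdist_walk/con.
pose f := [ffun v => if v \in C :\ r then
  odflt v [pick u | adj F u v & u \in preds G r v] else v].
have fE v : v \in C :\ r -> adj F (f v) v /\ f v \in preds G r v.
  move=> vC; rewrite ffunE vC; case: pickP => [u /andP[] //|no].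
  by have [u u1 u2] := ex v vC; have := no u; rewrite /= u1 u2.
have fP : f \in family parents.
  apply/familyP => v; rewrite /parents; case: ifPn => vC.
    by have [] := fE v vC.
  by rewrite ffunE (negPf vC) inE.
exists f => //; apply: (acyclic_connected_sub (V := C)) => //.
- apply/fintype.subsetP => e /imsetP[v vC ->].
  by have [/andP[_]] := fE v vC; rewrite finset.setUC.
- exact: fintype.subset_trans sFG G2.
by have [[_ [_ +]] _] := parent_tree_spt fP.
Qed.

Lemma num_spt_prod : G \subset all_edges T ->
  num_spt G r = \prod_v #|parents v|.
Proof.
move=> G2; rewrite /num_spt.
have -> : [set F : edge_set T | `[< shortest_path_tree G r F >] ]%SET =
          parent_tree @: [set f in family parents].
  apply/setP => F; rewrite inE; apply/asboolP/imsetP => [|[f fP ->]].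
    by move=> /(spt_parent_tree G2)[f fP ->]; exists f; rewrite ?inE.
  by apply: parent_tree_spt; rewrite inE in fP.
rewrite card_in_imset; last first.
  by move=> f g; rewrite !inE; exact: parent_tree_inj.
by rewrite cardsE card_family foldrE big_map big_enum.
Qed.

End ParentFunctions.

(** * Breadth-first search *)

Section BreadthFirstSearch.
Variable T : finType.
Implicit Types (G : edge_set T) (B S : {set T}) (st : {set T} * {set T}).
Implicit Types (r u v w : T).

Definition star v S : edge_set T := [set [set v; u] | u in S].

(** Counting edges instead of neighbours makes the degree visibly a function of the trace of [G] on
    a fixed edge set; both its law and its independence properties are read off from this. *)
Definition deg_in G S v : nat := #|G :&: star v S|.

Definition frontier G st : {set T} :=
  [set v | v \notin st.1 & 0 < deg_in G st.2 v].

Definition bfs_step G st := (st.1 :|: frontier G st, frontier G st).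

(* The pair (ball, sphere) of radius [d] around [r]. *)
Definition bfs G r d := iter d (bfs_step G) ([set r], [set r]).

Lemma set2_inj v u w : [set v; u] = [set v; w] -> u = w.
Proof.
move=> E; have : u \in [set v; w] by rewrite -E !inE eqxx orbT.
have : w \in [set v; u] by rewrite E !inE eqxx orbT.
by move=> /set2P[] -> // /set2P[].
Qed.

Lemma card_star v S : #|star v S| = #|S|.
Proof. by apply: card_imset => u w; exact: set2_inj. Qed.

Lemma deg_inE G S v : deg_in G S v = #|[set u in S | [set v; u] \in G]|.
Proof.
have -> : #|[set u in S | [set v; u] \in G]| =
    #|[set [set v; u] | u in [set u in S | [set v; u] \in G]]|.
  by rewrite card_imset // => u w; exact: set2_inj.
apply: eq_card => e; rewrite inE; apply/andP/imsetP => [[eG /imsetP[u uS eE]]|].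
  by exists u; rewrite // inE uS -eE.
move=> [u + eE]; rewrite inE => /andP[uS uG]; rewrite eE; split=> //.
by apply/imsetP; exists u.
Qed.

Lemma deg_in_gt0 G S v : v \notin S ->
  (0 < deg_in G S v) = [exists u in S, adj G u v].
Proof.
move=> vS; rewrite deg_inE; apply/card_gt0P/existsP.
  move=> [u]; rewrite inE => /andP[uS uG]; exists u; rewrite uS /adj /=.
  by rewrite finset.setUC uG andbT; apply/eqP => uv; rewrite uv (negPf vS) in uS.
move=> [u /andP[uS /andP[uv uG]]]; exists u; rewrite inE uS finset.setUC //.
Qed.

(** Both halves are proved in one induction, because the next frontier is computed from the sphere
    and excludes the ball. *)
Lemma bfs_walk G r d v :
  (v \in (bfs G r d).1) = [exists j : 'I_d.+1, walk G j r v] /\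
  (v \in (bfs G r d).2) = walk G d r v && (gdist G r v == d).
Proof.
elim: d v => [|d IH] v.
  split; rewrite inE.
    apply/eqP/existsP => [->|[j]]; first by exists ord0; rewrite walk0.
    by rewrite ord1 walk0 => /eqP.
  rewrite walk0 eq_sym; case: eqP => //= ->; by rewrite gdistxx.
have SB w : w \in (bfs G r d).2 -> w \in (bfs G r d).1.
  rewrite (IH w).1 (IH w).2 => /andP[ww _]; apply/existsP.
  by exists ord_max.
have S2 : (v \in (bfs G r d.+1).2) = walk G d.+1 r v && (gdist G r v == d.+1).
  rewrite /= inE; apply/andP/andP => [[vB]|[wv /eqP dv]].
    rewrite deg_in_gt0; last by apply: contra vB; exact: SB.
    move=> /existsP[u /andP[]]; rewrite (IH u).2 => /andP[ru du] uv.
    have rv : walk G d.+1 r v by apply/walkSP; exists u.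
    split=> //; rewrite eqn_leq (gdist_min rv) /= ltnNge; apply: contra vB => dv.
    rewrite (IH v).1; apply/existsP.
    exists (Ordinal (dv : (gdist G r v < d.+1)%N)).
    exact/gdist_walk/(walk_connect rv).
  have vB : v \notin (bfs G r d).1.
    rewrite (IH v).1; apply/existsP => -[j /gdist_min].
    by rewrite dv leqNgt ltn_ord.
  split=> //; rewrite deg_in_gt0; last by apply: contra vB; exact: SB.
  case/walkSP: wv => u ru uv; apply/existsP; exists u; rewrite uv andbT.
  rewrite (IH u).2 ru eqn_leq (gdist_min ru) /=.
  by have := gdist_adj (walk_connect ru) uv; rewrite dv ltnS.
split=> //; have -> : (v \in (bfs G r d.+1).1) =
  (v \in (bfs G r d).1) || (v \in (bfs G r d.+1).2) by rewrite /= inE.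
rewrite S2 (IH v).1; apply/orP/existsP.
  move=> [/existsP[j jv]|/andP[wv _]]; last by exists ord_max.
  by exists (widen_ord (leqnSn _) j).
move=> [j wv]; have cv := walk_connect wv.
have := gdist_min wv; have := ltn_ord j; rewrite ltnS => jd dj.
case: (ltngtP (gdist G r v) d.+1) => [dv|dv|dv].
- left; apply/existsP; exists (Ordinal dv); exact: gdist_walk.
- by have := leq_trans dv (leq_trans dj jd); rewrite ltnn.
- by right; rewrite -dv gdist_walk.
Qed.

Lemma sphereP G r d v : reflect
  (connect (adj G) r v /\ gdist G r v = d) (v \in (bfs G r d).2).
Proof.
rewrite (bfs_walk G r d v).2; apply: (iffP andP) => [[/walk_connect ? /eqP]|] //.
by move=> [/gdist_walk + <-].
Qed.

Lemma ballP G r d v : reflect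
  (connect (adj G) r v /\ gdist G r v <= d) (v \in (bfs G r d).1).
Proof.
rewrite (bfs_walk G r d v).1; apply: (iffP existsP) => [[j wv]|[cv dv]].
  split; [exact: walk_connect wv|].
  by apply: leq_trans (gdist_min wv) _; rewrite -ltnS.
exists (Ordinal (dv : (gdist G r v < d.+1)%N)); exact: gdist_walk.
Qed.

Lemma ball_sub G r d d' v :
  d <= d' -> v \in (bfs G r d).1 -> v \in (bfs G r d').1.
Proof. by move=> le /ballP[cv dv]; apply/ballP; rewrite (leq_trans dv). Qed.

Lemma sphere_sub_ball G r d : (bfs G r d).2 \subset (bfs G r d).1.
Proof. by apply/fintype.subsetP => v /sphereP[? ?]; apply/ballP; subst. Qed.

Lemma card_ballS G r d : #|(bfs G r d.+1).1| =
  #|(bfs G r d).1| + #|(bfs G r d.+1).2|.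
Proof.
rewrite /= cardsU; have -> : (bfs G r d).1 :&: frontier G (bfs G r d) = finset.set0.
  by apply/setP => v; rewrite !inE; case: (v \in _).
by rewrite cards0 subn0.
Qed.

Lemma card_preds_sphere G r d v : v \in (bfs G r d.+1).2 ->
  #|preds G r v| = deg_in G (bfs G r d).2 v.
Proof.
move=> /sphereP[cv dv]; rewrite deg_inE; apply: eq_card => u; rewrite !inE dv.
apply/andP/andP => [[uv du]|[/sphereP[cu du] uG]].
  split; last by case/andP: uv; rewrite finset.setUC.
  apply/sphereP; split; last by move/eqP: du => [].
  by apply: connect_trans cv _; apply: connect1; rewrite adj_sym.
rewrite du eqxx; split=> //; apply/andP; rewrite finset.setUC; split=> //.
by apply/eqP => uv; have := n_Sn d; rewrite -[X in X <> _]du uv dv.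
Qed.

Lemma card_preds_deg G r v : #|preds G r v| <= deg_in G [set~ v] v.
Proof.
rewrite deg_inE; apply/subset_leq_card/fintype.subsetP => u.
by rewrite !inE => /andP[/andP[uv uG] _]; rewrite uv finset.setUC.
Qed.

Lemma deg_in_eq0 G r d v : v \notin (bfs G r d.+1).1 ->
  deg_in G (bfs G r d).2 v = 0.
Proof.
by rewrite /= !inE negb_or => /andP[-> /=]; rewrite -leqNgt leqn0 => /eqP.
Qed.

End BreadthFirstSearch.

Arguments bfs : simpl never.

(** * The logarithm of the number of trees as a sum over layers *)

Section LogSpt.
Local Open Scope ring_scope.
Variables (R : realType) (T : finType) (r : T).
Implicit Types (G : edge_set T).

Definition lnmax1 (x : nat) : R := ln (maxn x 1)%:R.

(** Because [lnmax1 0 = 0], the sum may run over the whole complement of the ball, which is known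
    before the next edges are revealed, instead of over the next sphere. *)
Definition layer_sum G (st : {set T} * {set T}) : R :=
  \sum_(v in ~: st.1) lnmax1 (deg_in G st.2 v).

Lemma lnmax1_ge0 x : 0 <= lnmax1 x.
Proof. by apply: ln_ge0; rewrite ler1n leq_max orbT. Qed.

Lemma lnmax1_0 : lnmax1 0 = 0.
Proof. by rewrite /lnmax1 max0n ln1. Qed.

Lemma lnmax1_le x y : (x <= y)%N -> lnmax1 x <= lnmax1 y.
Proof.
move=> xy; rewrite /lnmax1 ler_ln ?posrE ?ltr0n ?leq_max ?orbT //.
by rewrite ler_nat geq_max leq_max xy leq_max /= orbT.
Qed.

Lemma ln_num_spt G : G \subset all_edges T ->
  ln (num_spt G r)%:R = \sum_v lnmax1 #|parents G r v| :> R.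
Proof.
move=> G2; rewrite num_spt_prod // natr_prod.
have pos v : (0 < #|parents G r v|)%N.
  rewrite /parents; case: ifP => [|_]; last by rewrite cards1.
  by rewrite !inE => /andP[vr cv]; exact: preds_neq0.
have E v : lnmax1 #|parents G r v| = ln (#|parents G r v|%:R : R).
  by rewrite /lnmax1 (maxn_idPl _).
rewrite (eq_bigr _ (fun v _ => E v)).
suff [_ ->] : 0 < \prod_v (#|parents G r v|%:R : R) /\
    ln (\prod_v (#|parents G r v|%:R : R)) = \sum_v ln (#|parents G r v|%:R : R).
  by [].
elim/big_rec2: _ => [|v y x _ [x0 <-]]; first by rewrite ltr01 ln1.
by rewrite mulr_gt0 ?ltr0n // lnM ?posrE ?ltr0n.
Qed.

(* The vertices at distance [k + 1] and [k + 2] carry the two layer sums; every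
   other contribution is nonnegative and at most logarithmic in the degree. *)
Lemma ln_num_spt_layers G k : G \subset all_edges T ->
  0 <= ln (num_spt G r)%:R - layer_sum G (bfs G r k) - layer_sum G (bfs G r k.+1)
    <= \sum_(v in (bfs G r k).1 :|: ~: (bfs G r k.+2).1)
         lnmax1 (deg_in G [set~ v] v).
Proof.
move=> G2; pose B j := (bfs G r j).1; rewrite -!/(B _).
rewrite ln_num_spt // /layer_sum -addrA -opprD.
rewrite (big_mkcond (mem (~: (bfs G r k).1))) (big_mkcond (mem (~: (bfs G r k.+1).1))).
rewrite -big_split -sumrB /= (big_mkcond (mem (B k :|: _))) /=.
pose rest v := lnmax1 #|parents G r v| -
  ((if v \in ~: (bfs G r k).1 then lnmax1 (deg_in G (bfs G r k).2 v) else 0) +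
   (if v \in ~: (bfs G r k.+1).1 then lnmax1 (deg_in G (bfs G r k.+1).2 v) else 0)).
suff bnd v : 0 <= rest v <= if v \in B k :|: ~: B k.+2 then
    lnmax1 (deg_in G [set~ v] v) else 0.
  by rewrite sumr_ge0 ?ler_sum // => v _; have /andP[] := bnd v.
have par_le : lnmax1 #|parents G r v| <= lnmax1 (deg_in G [set~ v] v).
  rewrite /parents; case: ifP => _; first exact/lnmax1_le/card_preds_deg.
  by rewrite cards1 /lnmax1 maxnn ln1; exact: lnmax1_ge0.
have par_sphere j : v \in (bfs G r j.+1).2 ->
    lnmax1 #|parents G r v| = lnmax1 (deg_in G (bfs G r j).2 v).
  move=> vS; rewrite -(card_preds_sphere vS) /parents; case/sphereP: vS => cv dv.
  have vr : v != r by apply/eqP => vr; rewrite vr gdistxx in dv.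
  by rewrite !inE vr cv.
rewrite /rest /B finset.in_setU !finset.in_setC.
case: (boolP (v \in (bfs G r k).1)) => vk /=.
  by rewrite (ball_sub (leqnSn k) vk) /= addr0 subr0 lnmax1_ge0.
case: (boolP (v \in (bfs G r k.+1).1)) => vk1 /=.
  rewrite (ball_sub (leqnSn k.+1) vk1) /= addr0 (par_sphere k) ?subrr ?lexx //.
  by move: vk1; rewrite [bfs G r k.+1]iterS finset.in_setU (negPf vk).
rewrite deg_in_eq0 // lnmax1_0 add0r.
case: (boolP (v \in (bfs G r k.+2).1)) => vk2.
  rewrite (par_sphere k.+1) ?subrr ?lexx //.
  by move: vk2; rewrite [bfs G r k.+2]iterS finset.in_setU (negPf vk1).
by rewrite -[frontier _ _]/((bfs G r k.+1).2) deg_in_eq0 // lnmax1_0 subr0 lnmax1_ge0.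
Qed.

End LogSpt.

(** * Expectation under the product measure on edge sets *)

Section ProductMeasure.
Local Open Scope ring_scope.
Variables (R : realFieldType) (I : finType) (E : {set I}) (p : R).
Hypothesis p01 : 0 <= p <= 1.
Implicit Types (G A : {set I}) (f g h : {set I} -> R).

Definition edge_weight (e : I) (b : bool) : R :=
  if e \in E then (if b then p else 1 - p) else (~~ b)%:R.

(* The law of a random subset of [E]; it gives mass 0 to every set that is not
   included in [E]. *)
Definition mass G : R := \prod_e edge_weight e (e \in G).

Definition expect f : R := \sum_G mass G * f G.

Lemma mass_ge0 G : 0 <= mass G.
Proof.
apply: prodr_ge0 => e _; rewrite /edge_weight.
by do 2 case: ifP => // _; case/andP: p01 => ? ?; rewrite ?subr_ge0.
Qed.

Lemma mass_notsub G : ~~ (G \subset E) -> mass G = 0.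
Proof.
case/subsetPn => e eG eE; rewrite /mass (bigD1 e) //= /edge_weight (negPf eE) eG.
by rewrite mul0r.
Qed.

Lemma mass_sub G : G \subset E ->
  mass G = \prod_(e in E) (if e \in G then p else 1 - p).
Proof.
move=> GE; rewrite /mass [RHS]big_mkcond; apply: eq_bigr => e _.
rewrite /edge_weight; case: ifPn => // eE.
by have /negPf -> : e \notin G by apply: contra eE; exact: (fintype.subsetP GE).
Qed.

Let prodrD (F G : I -> R) : \prod_i (F i + G i) =
  \sum_(J : {set I}) \prod_i (if i \in J then F i else G i).
Proof. exact: bigA_distr. Qed.

Lemma expect1 : expect (fun=> 1) = 1.
Proof.
rewrite /expect; under eq_bigr do rewrite mulr1.
have := prodrD (fun e => edge_weight e true) (fun e => edge_weight e false).
rewrite big1 => [->|e _]; last first.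
  by rewrite /edge_weight; case: ifP => _; [rewrite addrC subrK|rewrite add0r].
by apply: eq_bigr => G _; apply: eq_bigr => e _; case: ifP.
Qed.

Lemma eq_expect f g : (forall G, G \subset E -> f G = g G) ->
  expect f = expect g.
Proof.
move=> fg; apply: eq_bigr => G _; case: (boolP (G \subset E)) => [/fg -> //|GE].
by rewrite mass_notsub ?mul0r.
Qed.

Lemma le_expect f g : (forall G, G \subset E -> f G <= g G) ->
  expect f <= expect g.
Proof.
move=> fg; apply: ler_sum => G _; case: (boolP (G \subset E)) => [GE|GE].
  by rewrite ler_wpM2l ?mass_ge0 ?fg.
by rewrite mass_notsub ?mul0r.
Qed.

Lemma expectD f g : expect (fun G => f G + g G) = expect f + expect g.
Proof. by rewrite -big_split; apply: eq_bigr => G _; rewrite mulrDr. Qed.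

Lemma expectZ c f : expect (fun G => c * f G) = c * expect f.
Proof. by rewrite mulr_sumr; apply: eq_bigr => G _; rewrite mulrCA. Qed.

Lemma expectZr c f : expect (fun G => f G * c) = expect f * c.
Proof. by rewrite mulr_suml; apply: eq_bigr => G _; rewrite mulrA. Qed.

Lemma expect_cst c : expect (fun=> c) = c.
Proof.
by rewrite -[RHS]mulr1 -expect1 -expectZ; apply: eq_expect => ? _; rewrite mulr1.
Qed.

Lemma expectN f : expect (fun G => - f G) = - expect f.
Proof. by rewrite -mulN1r -expectZ; apply: eq_expect => G _; rewrite mulN1r. Qed.

Lemma expectB f g : expect (fun G => f G - g G) = expect f - expect g.
Proof. by rewrite expectD expectN. Qed.

Lemma expect_sum (J : finType) (P : pred J) (F : J -> {set I} -> R) :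
  expect (fun G => \sum_(j | P j) F j G) = \sum_(j | P j) expect (F j).
Proof.
rewrite exchange_big /=; apply: eq_bigr => G _; exact: mulr_sumr.
Qed.

Lemma expect_ge0 f : (forall G, G \subset E -> 0 <= f G) -> 0 <= expect f.
Proof. by move=> f0; rewrite -(expect_cst 0); exact: le_expect. Qed.

Lemma markov_expect f (a : R) : 0 < a -> (forall G, G \subset E -> 0 <= f G) ->
  expect (fun G => (a < f G)%R%:R) <= expect f / a.
Proof.
move=> a0 f0; rewrite -expectZr; apply: le_expect => G GE.
rewrite ler_pdivlMr //; case: ltP => [/ltW|_]; rewrite ?mul1r // mul0r.
exact: f0.
Qed.

Definition mix A G1 G2 := (G1 :&: A) :|: (G2 :\: A).

Lemma mixK A G1 G2 : mix A (mix A G1 G2) (mix A G2 G1) = G1.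
Proof. by apply/setP => e; rewrite !inE; do !case: (e \in _). Qed.

(* Swapping the traces of two independent copies on [A] preserves their joint
   law. *)
Lemma expect_split A h :
  expect h = expect (fun G1 => expect (fun G2 => h (mix A G1 G2))).
Proof.
transitivity (\sum_(x : {set I} * {set I}) mass x.1 * mass x.2 * h x.1).
  rewrite -(pair_bigA _ (fun x y => mass x * mass y * h x)) /=.
  apply: eq_bigr => G1 _.
  under eq_bigr do rewrite mulrAC mulrC.
  by rewrite -mulr_suml; have := expect1; rewrite /expect;
    under eq_bigr do rewrite mulr1; move=> ->; rewrite mul1r.
rewrite /expect; under [RHS]eq_bigr do rewrite mulr_sumr.
rewrite pair_big /= (reindex_inj (h := fun x => (mix A x.1 x.2, mix A x.2 x.1))).
  apply: eq_bigr => -[G1 G2] _ /=; rewrite mulrA; congr (_ * _).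
  rewrite -!big_split /=; apply: eq_bigr => e _.
  rewrite !inE; case: (e \in A); rewrite ?andbT ?andbF ?orbF //=.
  by rewrite mulrC.
apply: (can_inj (g := fun x => (mix A x.1 x.2, mix A x.2 x.1))) => -[G1 G2] /=.
by rewrite !mixK.
Qed.

Definition depends_on A (U : Type) (f : {set I} -> U) :=
  forall G, f (G :&: A) = f G.

Lemma depends_on_sub A A' U (f : {set I} -> U) : A \subset A' ->
  depends_on A f -> depends_on A' f.
Proof.
by move=> AA' fA G; rewrite -fA -finset.setIA (finset.setIidPr AA') fA.
Qed.

Lemma mix_setI A G1 G2 : mix A G1 G2 :&: A = G1 :&: A.
Proof. by apply/setP => e; rewrite !inE; do !case: (e \in _). Qed.

Lemma mix_setIC A G1 G2 : mix A G1 G2 :&: ~: A = G2 :&: ~: A.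
Proof. by apply/setP => e; rewrite !inE; do !case: (e \in _). Qed.

Lemma expect_indep A A' f g : [disjoint A & A'] ->
  depends_on A f -> depends_on A' g ->
  expect (fun G => f G * g G) = expect f * expect g.
Proof.
move=> dis fA gA'; rewrite (expect_split A).
have gA : depends_on (~: A) g.
  by apply: depends_on_sub gA'; rewrite finset.subsetC -finset.disjoints_subset.
rewrite -expectZr; apply: eq_expect => G1 _.
rewrite -expectZ; apply: eq_expect => G2 _.
by rewrite -fA mix_setI fA -gA mix_setIC gA.
Qed.

Lemma expect_edge e (phi : bool -> R) : e \in E ->
  expect (fun G => phi (e \in G)) = p * phi true + (1 - p) * phi false.
Proof.
(* The factor [phi] is attached to the coordinate [e] before the product of sums is expanded. *)
move=> eE; pose wt i b := edge_weight i b * (if i == e then phi b else 1).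
have := prodrD (fun i => wt i true) (fun i => wt i false).
rewrite (bigD1 e) //= big1 => [|i ie]; last first.
  rewrite /wt /edge_weight (negPf ie); case: ifP => _.
    by rewrite !mulr1 addrC subrK.
  by rewrite !mulr1 add0r.
rewrite mulr1 {1 2}/wt eqxx /edge_weight eE => ->; apply: eq_bigr => G _.
rewrite /mass (bigD1 e) //= [in RHS](bigD1 e) //= mulrAC; congr (_ * _).
  by rewrite /wt eqxx; case: ifP.
by apply: eq_bigr => i ie; rewrite /wt (negPf ie); case: ifP => _; rewrite mulr1.
Qed.

(** This is the mean of [g] under Binomial([s], [p]), by conditioning on one trial. Moments then
    follow by short inductions; binomial coefficients enter only in the comparison with Poisson
    weights. *)
Fixpoint binomial_mean (s : nat) (g : nat -> R) : R :=
  if s is s'.+1 then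
    (1 - p) * binomial_mean s' g + p * binomial_mean s' (fun j => g j.+1)
  else g 0%N.

Lemma eq_binomial_mean s (g g' : nat -> R) :
  g =1 g' -> binomial_mean s g = binomial_mean s g'.
Proof.
elim: s g g' => [|s IH] g g' gg' /=; first exact: gg'.
by rewrite (IH _ _ gg') (IH (fun j => g j.+1) (fun j => g' j.+1)).
Qed.

Lemma expect_card A (g : nat -> R) : A \subset E ->
  expect (fun G => g #|G :&: A|) = binomial_mean #|A| g.
Proof.
move En: #|A| => n; elim: n A En g => [|n IH] A En g AE.
  have -> : A = finset.set0 by apply/eqP; rewrite -cards_eq0 En.
  by rewrite -[RHS]expect_cst; apply: eq_expect => G _; rewrite finset.setI0 cards0.
have [e eA] : exists e, e \in A by apply/set0Pn; rewrite -cards_eq0 En.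
have eE : e \in E := fintype.subsetP AE _ eA.
pose A' := A :\ e; have A'n : #|A'| = n.
  by apply/eqP; rewrite -eqSS -En (cardsD1 e A) eA.
have A'E : A' \subset E by apply: fintype.subset_trans AE; exact: subsetDl.
rewrite (expect_split [set e]).
have cardE G1 G2 : #|mix [set e] G1 G2 :&: A| = ((e \in G1) + #|G2 :&: A'|)%N.
  rewrite (cardsD1 e); congr (_ + _)%N; first by rewrite !inE eqxx eA !andbT orbF.
  apply: eq_card => i; rewrite !inE; case: (i == e); rewrite ?andbF ?andbT //=.
transitivity (expect (fun G1 => binomial_mean n (fun j => g ((e \in G1) + j)%N))).
  apply: eq_expect => G1 _.
  by rewrite -(IH _ A'n (fun j => g ((e \in G1) + j)%N) A'E);
    apply: eq_expect => G2 _; rewrite cardE.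
rewrite (expect_edge (fun b : bool => binomial_mean n (fun j => g (b + j)%N))) //.
by rewrite addrC.
Qed.

(** The summands are pairwise uncorrelated, so only the diagonal terms remain; each is a variance,
    bounded by the second moment. *)
Lemma expect_sqr_sum (J : finType) (V : {set J}) (Y : J -> {set I} -> R) (c w : R) :
  (forall v, v \in V -> expect (Y v) = c) ->
  (forall v, v \in V -> expect (fun G => Y v G ^+ 2) <= w) ->
  (forall v v', v \in V -> v' \in V -> v != v' ->
     expect (fun G => Y v G * Y v' G) = c * c) ->
  expect (fun G => (\sum_(v in V) Y v G - #|V|%:R * c) ^+ 2) <= #|V|%:R * w.
Proof.
move=> Y1 Y2 Yi; pose Z v G := Y v G - c.
have -> : expect (fun G => (\sum_(v in V) Y v G - #|V|%:R * c) ^+ 2) =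
  expect (fun G => \sum_(v in V) \sum_(v' in V) Z v G * Z v' G).
  apply: eq_expect => G _; rewrite expr2 -big_distrlr /=.
  by rewrite /Z sumrB sumr_const mulr_natl.
rewrite expect_sum mulr_natl -sumr_const; apply: ler_sum => v vV.
rewrite expect_sum (bigD1 v) //= big1 => [|v' /andP[v'V ne]]; last first.
  rewrite (eq_expect (g := fun G => Y v G * Y v' G - (c * Y v G + c * Y v' G) + c * c)).
    rewrite expectD expectB expectD !expectZ expect_cst Yi ?Y1 //; first ring.
    by rewrite eq_sym.
  by move=> G _; rewrite /Z; ring.
rewrite addr0 (eq_expect (g := fun G => Y v G ^+ 2 - (2 * c) * Y v G + c * c)).
  rewrite expectD expectB !expectZ expect_cst Y1 //.
  by have := Y2 _ vV; have := sqr_ge0 c; rewrite expr2; lra.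
by move=> G _; rewrite /Z; ring.
Qed.

End ProductMeasure.

(** * Binomial means of the truncated logarithm *)

Section BinomialMean.
Local Open Scope ring_scope.
Variables (R : realType) (q : R).
Hypothesis q01 : 0 <= q <= 1.
Local Notation bm := (binomial_mean q).

Lemma le_binomial_mean s (g g' : nat -> R) :
  (forall j, g j <= g' j) -> bm s g <= bm s g'.
Proof.
have [q0 q1] := andP q01; elim: s g g' => [|s IH] g g' gg' /=; first exact: gg'.
by rewrite lerD // ler_wpM2l ?subr_ge0 ?IH.
Qed.

Lemma binomial_meanD s (g g' : nat -> R) :
  bm s (fun j => g j + g' j) = bm s g + bm s g'.
Proof. by elim: s g g' => [|s IH] g g' //=; rewrite !IH; ring. Qed.

Lemma binomial_meanZ s c (g : nat -> R) : bm s (fun j => c * g j) = c * bm s g.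
Proof. by elim: s g => [|s IH] g //=; rewrite !IH; ring. Qed.

Lemma binomial_mean_cst s c : bm s (fun=> c) = c.
Proof. by elim: s => [|s IH] //=; rewrite !IH; ring. Qed.

Lemma binomial_meanB s (g g' : nat -> R) :
  bm s (fun j => g j - g' j) = bm s g - bm s g'.
Proof.
rewrite binomial_meanD -[in RHS]mulN1r -binomial_meanZ; congr (_ + _).
by apply: eq_binomial_mean => j; rewrite mulN1r.
Qed.

Lemma binomial_mean_id s : bm s (fun j => j%:R) = s%:R * q.
Proof.
elim: s => [|s IH] /=; first by rewrite mul0r.
rewrite IH (@eq_binomial_mean _ _ _ (fun j : nat => j.+1%:R) (fun j => j%:R + 1)).
  by rewrite binomial_meanD IH binomial_mean_cst -natr1; ring.
by move=> j; rewrite natr1.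
Qed.

Lemma binomial_mean_sqr s c :
  bm s (fun j => (j%:R - c) ^+ 2) = s%:R * (q * (1 - q)) + (s%:R * q - c) ^+ 2.
Proof.
elim: s c => [|s IH] c /=; first by ring.
rewrite IH (@eq_binomial_mean _ _ _ (fun j : nat => (j.+1%:R - c) ^+ 2)
  (fun j => (j%:R - (c - 1)) ^+ 2)).
  by rewrite IH -natr1; ring.
by move=> j; rewrite -natr1; ring.
Qed.

Lemma binomial_mean_sqr_le s c :
  bm s (fun j => (j%:R - c) ^+ 2) <= s%:R * q + (s%:R * q - c) ^+ 2.
Proof.
rewrite binomial_mean_sqr lerD2r ler_wpM2l ?ler0n //.
by have := q01; nra.
Qed.

Lemma binomial_mean_gt0 s : bm s (fun j => (0 < j)%:R) = 1 - (1 - q) ^+ s.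
Proof.
elim: s => [|s IH] /=; first by rewrite expr0 subrr.
rewrite IH (@eq_binomial_mean _ _ _ (fun j : nat => (0 < j.+1)%:R) (fun j => 1)) //.
by rewrite binomial_mean_cst exprS; ring.
Qed.

(** Size biasing: a binomial variable weighted by its value is distributed as one plus a binomial
    variable with one trial fewer. *)
Lemma binomial_mean_size_bias s (g : nat -> R) :
  bm s.+1 (fun j => j%:R * g j) = s.+1%:R * q * bm s (fun j => g j.+1).
Proof.
elim: s g => [|s IH] g; first by rewrite /=; ring.
have -> : bm s.+2 (fun j => j%:R * g j) = (1 - q) * bm s.+1 (fun j => j%:R * g j) +
    q * bm s.+1 (fun j => j.+1%:R * g j.+1) by [].
rewrite IH (@eq_binomial_mean _ _ _ (fun j : nat => j.+1%:R * g j.+1)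
  (fun j => j%:R * g j.+1 + g j.+1)); last by move=> j; rewrite -natr1; ring.
rewrite binomial_meanD (IH (fun j => g j.+1)).
have -> : bm s.+1 (fun j => g j.+1) =
  (1 - q) * bm s (fun j => g j.+1) + q * bm s (fun j => g j.+2) by [].
by rewrite -(natr1 s.+1); ring.
Qed.

(** Size biasing is applied to [g j = 1 / j]; the product [j * g j] is 1 except at [j = 0], where it
    is 0. *)
Lemma binomial_mean_invS s : 0 < q ->
  bm s (fun j => j.+1%:R^-1) <= (s.+1%:R * q)^-1.
Proof.
move=> q0; have sq : 0 < s.+1%:R * q by rewrite mulr_gt0 ?ltr0n.
rewrite -[X in _ <= X]mul1r ler_pdivlMr // mulrC -(binomial_mean_size_bias s (fun j => j%:R^-1)).
rewrite -[X in _ <= X](binomial_mean_cst s.+1); apply: le_binomial_mean => -[|j].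
  by rewrite mul0r.
by rewrite divff // pnatr_eq0.
Qed.

Local Notation f := (lnmax1 R).

Lemma ln_le_subr1 (x : R) : 0 < x -> ln x <= x - 1.
Proof. by move=> x0; have := expR_ge1Dx (ln x); rewrite lnK ?posrE //; lra. Qed.

Lemma ln_ge_1subrV (x : R) : 0 < x -> 1 - x^-1 <= ln x.
Proof.
move=> x0; have xV : 0 < x^-1 by rewrite invr_gt0.
by have := ln_le_subr1 xV; rewrite lnV ?posrE //; lra.
Qed.

Lemma lnmax1_le_nat x : f x <= x%:R.
Proof.
case: x => [|x]; first by rewrite lnmax1_0.
rewrite /lnmax1 (maxn_idPl _) //.
by apply: le_trans (ln_le_subr1 _) _; rewrite ?ltr0n // gerBl.
Qed.

Lemma lnmax1_le_lin c x : 1 <= c -> f x <= ln c + x%:R / c.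
Proof.
move=> c1; have c0 : 0 < c by lra.
case: x => [|x]; first by rewrite lnmax1_0 mul0r addr0 ln_ge0.
rewrite /lnmax1 (maxn_idPl _) //.
have xc : 0 < x.+1%:R / c by rewrite divr_gt0 ?ltr0n.
have := ln_le_subr1 xc; rewrite ln_div ?posrE ?ltr0n //; lra.
Qed.

(** For [y = max(x, 1)] one has [ln y >= ln c + 1 - c / y] and [y >= (x + 1) / 2]. The reciprocal of
    [x + 1] is used because its binomial mean is controlled. *)
Lemma lnmax1_ge_lin c x : 0 < c -> ln c + 1 - 2 * c * x.+1%:R^-1 <= f x.
Proof.
move=> c0; set y : R := (maxn x 1)%:R.
have y0 : 0 < y by rewrite ltr0n leq_max orbT.
have := ln_ge_1subrV (divr_gt0 y0 c0); rewrite ln_div ?posrE // invf_div.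
have -> : f x = ln y by [].
suff : c / y <= 2 * c * x.+1%:R^-1.
  by set a := c / y; set b := _ * _^-1; set l := ln y; lra.
have xy : x.+1%:R <= 2 * y.
  rewrite -natrM ler_nat; case: x {y y0} => [|x] //.
  by rewrite (maxn_idPl _) // mul2n -addnn addSn ltnS leq_addl.
rewrite ler_pdivrMr // mulrAC ler_pdivlMr ?ltr0n // [2 * c]mulrC -mulrA.
by rewrite ler_pM2l.
Qed.

Lemma lnmax1_S_le x : f x.+1 - f x <= 2 * x.+1%:R^-1.
Proof.
case: x => [|x].
  by rewrite /lnmax1 /= !ln1 subrr invr1 mulr1.
rewrite /lnmax1 !(maxn_idPl _) //.
have := @ln_ge_1subrV (x.+1%:R / x.+2%:R); rewrite divr_gt0 ?ltr0n // => /(_ isT).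
rewrite ln_div ?posrE ?ltr0n // invf_div => H.
apply: (@le_trans _ _ (x.+2%:R / x.+1%:R - 1)).
  by rewrite -opprB lerNl opprB.
rewrite -[x.+2%:R]natr1 mulrDl divff ?pnatr_eq0 // mul1r addrAC subrr add0r.
rewrite -[X in X <= _]mul1r ler_pdivrMr ?ltr0n // mulrAC ler_pdivlMr ?ltr0n // mul1r.
by rewrite natr1 -natrM ler_nat mul2n -addnn addSn ltnS leq_addl.
Qed.

(** One more trial changes the mean by [q] times the mean increment of [f]. The mean of
    [1 / (X + 1)] is at most [1 / ((s + 1) q)], so [q] cancels and the mean depends on [s] at most
    logarithmically. *)
Lemma binomial_lnmax1_S s : 0 < q ->
  0 <= bm s.+1 f - bm s f <= 2 / s.+1%:R.
Proof.
move=> q0; have -> : bm s.+1 f - bm s f =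
    q * bm s (fun j => f j.+1 - f j).
  by rewrite binomial_meanB /=; ring.
apply/andP; split.
  rewrite mulr_ge0 ?(ltW q0) // -(binomial_mean_cst s 0); apply: le_binomial_mean.
  by move=> j; rewrite subr_ge0; apply: lnmax1_le; exact: leqnSn.
apply: (@le_trans _ _ (q * (2 * bm s (fun j => j.+1%:R^-1)))).
  rewrite ler_wpM2l ?(ltW q0) // -binomial_meanZ; apply: le_binomial_mean.
  exact: lnmax1_S_le.
have := binomial_mean_invS s q0; rewrite invfM => H.
rewrite mulrCA ler_pM2l ?ltr0n //.
by apply: le_trans (ler_wpM2l (ltW q0) H) _; rewrite mulrCA divff ?gt_eqF // mulr1.
Qed.

Lemma binomial_lnmax1_dist s t : 0 < q ->
  `|bm t f - bm s f| <= 2 * `|t%:R - s%:R| / (minn s t).+1%:R.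
Proof.
wlog st : s t / (s <= t)%N => [hwlog q0|q0].
  case/orP: (leq_total s t) => st; first exact: hwlog.
  by have := hwlog t s st q0; rewrite minnC (distrC (bm s _)) (distrC s%:R).
rewrite (minn_idPl st).
suff /andP[b0 b1] : 0 <= bm t f - bm s f <= 2 * (t%:R - s%:R) / s.+1%:R.
  by rewrite ger0_norm // [`|t%:R - _|]ger0_norm // subr_ge0 ler_nat.
elim: t st => [|t IH]; first by rewrite leqn0 => /eqP ->; rewrite !subrr mulr0 mul0r lexx.
rewrite leq_eqVlt => /predU1P[->|]; first by rewrite !subrr mulr0 mul0r lexx.
rewrite ltnS => st; have /andP[b0 b1] := IH st.
have /andP[c0 c1] := binomial_lnmax1_S t q0.
have c2 : 2 / t.+1%:R <= 2 / s.+1%:R :> R.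
  by rewrite ler_pM2l ?ltr0n // lef_pV2 ?posrE ?ltr0n // ler_nat ltnS.
have -> : 2 * (t.+1%:R - s%:R) / s.+1%:R =
    2 * (t%:R - s%:R) / s.+1%:R + 2 / s.+1%:R :> R.
  by rewrite -mulrDl -[t.+1%:R]natr1; congr (_ / _); ring.
rewrite -(subrKA (bm t f)) addr_ge0 //= addrC lerD //.
exact: le_trans c1 c2.
Qed.

Lemma binomial_lnmax1_le c s : 1 <= c -> bm s f <= ln c + s%:R * q / c.
Proof.
move=> c1; apply: le_trans (le_binomial_mean _ (fun x => lnmax1_le_lin x c1)) _.
rewrite binomial_meanD binomial_mean_cst lerD2l.
rewrite (eq_binomial_mean _ _ (g' := fun j => c^-1 * j%:R)) => [|j]; last exact: mulrC.
by rewrite binomial_meanZ binomial_mean_id mulrC.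
Qed.

Lemma binomial_lnmax1_ge c s : 0 < q -> 0 < c ->
  ln c + 1 - 2 * c / (s.+1%:R * q) <= bm s f.
Proof.
move=> q0 c0; apply: le_trans (le_binomial_mean _ (fun x => lnmax1_ge_lin x c0)).
rewrite binomial_meanB binomial_mean_cst lerD2l binomial_meanZ lerN2.
rewrite ler_wpM2l ?mulr_ge0 ?(ltW c0) //; exact: binomial_mean_invS.
Qed.

Lemma onem_pow_ge s : s%:R * q - (s%:R * q) ^+ 2 <= 1 - (1 - q) ^+ s <= s%:R * q.
Proof.
have [q0 q1] := andP q01.
elim: s => [|s /andP[IH1 IH2]]; first by rewrite expr0 mul0r; lra.
rewrite [(1 - q) ^+ s.+1]exprS -[s.+1%:R]natr1; set x := (1 - q) ^+ s in IH1 IH2 *.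
have x1 : x <= 1 by rewrite exprn_ile1 ?subr_ge0 //; lra.
have y0 : 0 <= s%:R * q by rewrite mulr_ge0 ?ler0n.
rewrite [(s%:R + 1) * q]mulrDl mul1r mulrBl mul1r; set y := s%:R * q in IH1 IH2 y0 *.
have qx : q * x <= q by rewrite ler_piMr.
have qx' : q * (1 - y) <= q * x by rewrite ler_wpM2l //; lra.
have := mulr_ge0 q0 y0; have := mulr_ge0 q0 q0.
move: IH1; rewrite !expr2 => *; apply/andP; split; lra.
Qed.

End BinomialMean.

(** * Conditioning on the explored part of the graph *)

Section Exploration.
Local Open Scope ring_scope.
Variables (R : realType) (T : finType) (r : T) (q : R).
Hypothesis q01 : 0 <= q <= 1.
Implicit Types (G : edge_set T) (st : {set T} * {set T}) (v w : T) (S : {set T}).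
Local Notation EE := (expect (all_edges T) q).
Local Notation bm := (binomial_mean q).
Local Notation D := (#|T|%:R * q).

(* The edges revealed by a search that has reached the state [st]. *)
Definition touched st : edge_set T :=
  [set e : {set T} | ~~ [disjoint e & st.1 :\: st.2]].

(** Spheres of radius [j < d] lie in the interior of the ball of radius [d], so every star queried
    during the first [d] steps consists of touched edges. *)
Lemma bfs_agree G G' d : G :&: touched (bfs G r d) = G' :&: touched (bfs G r d) ->
  bfs G' r d = bfs G r d.
Proof.
move=> agree; suff : forall j, (j <= d)%N -> bfs G' r j = bfs G r j by exact.
elim=> [//|j IH] jd.
rewrite [LHS]iterS [RHS]iterS -![iter j _ _]/(bfs _ r j) (IH (ltnW jd)).
suff E : frontier G' (bfs G r j) = frontier G (bfs G r j) by rewrite /bfs_step E.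
apply/setP => v; rewrite !inE; congr (_ && (0 < _)%N).
suff sub : star v (bfs G r j).2 \subset touched (bfs G r d).
  by rewrite /deg_in -(finset.setIidPr sub) !finset.setIA agree.
apply/fintype.subsetP => e /imsetP[u uS ->]; rewrite inE.
apply/negP => /disjoint_setI0/setP/(_ u); rewrite !inE eqxx orbT /=.
case/sphereP: uS => cu du; have -> : u \in (bfs G r d).1.
  by apply/ballP; rewrite du ltnW.
by rewrite andbT => /negbT/negPn/sphereP[_]; rewrite du => jE; rewrite jE ltnn in jd.
Qed.

(** The set of revealed edges is random, but the event of reaching [st] is decided by the fixed set
    [touched st]: a graph and its trace on that set run the same search as soon as one of them
    reaches [st]. *)
Lemma bfs_depends d st :
  depends_on (touched st) (fun G => (bfs G r d == st)%:R : R).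
Proof.
move=> G; congr (_ %:R); congr nat_of_bool; apply/eqP/eqP => E;
  by apply: (etrans _ E); apply: bfs_agree; rewrite E -finset.setIA finset.setIid.
Qed.

(* The edges that the search has not yet revealed may be resampled. *)
Lemma bfs_markov d (F : {set T} * {set T} -> edge_set T -> R) :
  (forall st, st.2 \subset st.1 -> depends_on (~: touched st) (F st)) ->
  EE (fun G => F (bfs G r d) G) = EE (fun G => EE (F (bfs G r d))).
Proof.
move=> Fdep.
have sumE (H : {set T} * {set T} -> edge_set T -> R) :
    EE (fun G => H (bfs G r d) G) = \sum_st EE (fun G => (bfs G r d == st)%:R * H st G).
  rewrite -expect_sum; apply: eq_expect => G _.
  rewrite (bigD1 (bfs G r d)) //= eqxx mul1r big1 ?addr0 // => st /negPf.
  by rewrite eq_sym => ->; rewrite mul0r.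
rewrite (sumE F) (sumE (fun st _ => EE (F st))); apply: eq_bigr => st _.
have [sub|nsub] := boolP (st.2 \subset st.1); last first.
  by apply: eq_expect => G _; case: eqP => [E|]; rewrite ?mul0r //;
    rewrite -E sphere_sub_ball in nsub.
rewrite expectZr (@expect_indep _ _ _ _ (touched st) (~: touched st)) //.
- by rewrite -finset.setI_eq0 finset.setICr.
- exact: bfs_depends.
- exact: Fdep.
Qed.

Lemma star_edges v S : v \notin S -> star v S \subset all_edges T.
Proof.
move=> vS; apply/fintype.subsetP => e /imsetP[u uS ->]; rewrite inE cards2.
by case: (v =P u) => // vu; rewrite vu uS in vS.
Qed.

Lemma star_untouched st v : st.2 \subset st.1 -> v \notin st.1 ->
  star v st.2 \subset ~: touched st.
Proof.
move=> sub vB; apply/fintype.subsetP => e /imsetP[u uS ->]; rewrite !inE negbK.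
rewrite -finset.setI_eq0; apply/eqP/setP => w; rewrite !inE.
by case: eqP => [->|_] /=; [rewrite (negPf vB) andbF|case: eqP => [->|] //=; rewrite uS].
Qed.

Lemma deg_in_depends S v : depends_on (star v S) (fun G => deg_in G S v).
Proof. by move=> G; rewrite /deg_in -finset.setIA finset.setIid. Qed.

Lemma frontier_depends st : st.2 \subset st.1 ->
  depends_on (~: touched st) (fun G => frontier G st).
Proof.
move=> sub G; apply/setP => v; rewrite !inE.
case: (boolP (v \in _)) => //= vB.
by rewrite (depends_on_sub (star_untouched sub vB) (@deg_in_depends st.2 v)).
Qed.

Lemma sum_deg_depends st (g : nat -> R) : st.2 \subset st.1 ->
  depends_on (~: touched st) (fun G => \sum_(v in ~: st.1) g (deg_in G st.2 v)).
Proof.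
move=> sub G; apply: eq_bigr => v; rewrite inE => vB.
by rewrite (depends_on_sub (star_untouched sub vB) (@deg_in_depends st.2 v)).
Qed.

Lemma expect_deg S v (g : nat -> R) : v \notin S ->
  EE (fun G => g (deg_in G S v)) = bm #|S| g.
Proof. by move=> vS; rewrite -(card_star v) -(expect_card _ _ (star_edges vS)). Qed.

Lemma expect_sum_deg st (g : nat -> R) : st.2 \subset st.1 ->
  EE (fun G => \sum_(v in ~: st.1) g (deg_in G st.2 v)) =
  #|~: st.1|%:R * bm #|st.2| g.
Proof.
move=> sub; rewrite expect_sum mulr_natl -sumr_const; apply: eq_bigr => v.
by rewrite inE => vB; rewrite expect_deg //; apply: contra vB; exact: fintype.subsetP.
Qed.

(** The stars of distinct vertices outside the ball into the sphere share no edge, so the degrees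
    are independent. *)
Lemma variance_sum_deg st (g : nat -> R) : st.2 \subset st.1 ->
  EE (fun G => (\sum_(v in ~: st.1) g (deg_in G st.2 v) -
                #|~: st.1|%:R * bm #|st.2| g) ^+ 2)
    <= #|~: st.1|%:R * bm #|st.2| (fun j => g j ^+ 2).
Proof.
move=> sub; have nS v : v \in ~: st.1 -> v \notin st.2.
  by rewrite inE; apply: contra; exact: fintype.subsetP.
apply: expect_sqr_sum => [v /nS vS|v /nS vS|v w /nS vS /nS wS vw].
- exact: expect_deg.
- by rewrite (expect_deg (fun j => g j ^+ 2)).
rewrite (@expect_indep _ _ _ _ (star v st.2) (star w st.2)) ?expect_deg //.
- rewrite -finset.setI_eq0; apply/eqP/setP => e; rewrite !inE; apply/negP.
  move=> /andP[/imsetP[u uS ->] /imsetP[u' u'S]].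
  move=> E; have : v \in [set w; u'] by rewrite -E !inE eqxx.
  by move=> /set2P[vE|vE]; [rewrite vE eqxx in vw|rewrite vE u'S in vS].
- by move=> G; rewrite -[in RHS]deg_in_depends.
- by move=> G; rewrite -[in RHS]deg_in_depends.
Qed.

Definition reach (s : nat) : R := 1 - (1 - q) ^+ s.

Lemma card_frontier G st :
  #|frontier G st|%:R = \sum_(v in ~: st.1) (0 < deg_in G st.2 v)%:R :> R.
Proof.
rewrite -sum1_card natr_sum big_mkcond [RHS]big_mkcond; apply: eq_bigr => v _.
by rewrite !inE; case: (v \in _) => //=; case: (0 < _)%N.
Qed.

Lemma expect_frontier st : st.2 \subset st.1 ->
  EE (fun G => #|frontier G st|%:R) = #|~: st.1|%:R * reach #|st.2|.
Proof.
move=> sub; rewrite /reach -binomial_mean_gt0 -(expect_sum_deg (fun j => (0 < j)%:R)) //.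
by apply: eq_expect => G _; exact: card_frontier.
Qed.

Lemma variance_frontier st : st.2 \subset st.1 ->
  EE (fun G => (#|frontier G st|%:R - #|~: st.1|%:R * reach #|st.2|) ^+ 2)
    <= #|~: st.1|%:R * reach #|st.2|.
Proof.
move=> sub; have := variance_sum_deg (fun j => (0 < j)%:R) sub.
rewrite binomial_mean_gt0 (@eq_binomial_mean _ _ _ (fun j => _ ^+ 2) (fun j => (0 < j)%:R)).
  rewrite binomial_mean_gt0 => H; apply: le_trans _ H; apply: le_expect => // G _.
  by rewrite card_frontier.
by move=> [|j]; rewrite ?expr0n ?expr1n.
Qed.

Lemma mean_deg_ge0 : 0 <= D.
Proof. by rewrite mulr_ge0 ?ler0n; case/andP: q01. Qed.

Lemma reach_ge0 s : 0 <= reach s.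
Proof.
by have [? ?] := andP q01; rewrite subr_ge0 exprn_ile1 ?subr_ge0 //; lra.
Qed.

Lemma expect_frontier_le st : st.2 \subset st.1 ->
  EE (fun G => #|frontier G st|%:R) <= D * #|st.2|%:R.
Proof.
move=> sub; rewrite expect_frontier // -mulrA [q * _]mulrC ler_pM ?ler0n ?reach_ge0 //.
  by rewrite ler_nat max_card.
by have /andP[] := onem_pow_ge q01 #|st.2|.
Qed.

Lemma expect_frontier_sqr_le st : st.2 \subset st.1 ->
  EE (fun G => #|frontier G st|%:R ^+ 2) <=
  D * #|st.2|%:R + D ^+ 2 * #|st.2|%:R ^+ 2.
Proof.
move=> sub; have m1 := expect_frontier_le sub; have := variance_frontier sub.
rewrite (expect_frontier sub) in m1; have m0 := expect_frontier sub.
set m := _ * reach _ in m1 m0 *.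
rewrite (@eq_expect _ _ _ _ _ (fun G => #|frontier G st|%:R ^+ 2 -
    (2 * m) * #|frontier G st|%:R + m ^+ 2)); last by move=> G _; ring.
rewrite expectD expectB expectZ expect_cst m0.
have m2 : m ^+ 2 <= D ^+ 2 * #|st.2|%:R ^+ 2.
  have m00 : 0 <= m by rewrite mulr_ge0 ?ler0n ?reach_ge0.
  by rewrite -exprMn ler_sqr ?nnegrE ?(le_trans m00 m1).
by rewrite !expr2 in m2 *; lra.
Qed.

(* AM-GM with the free parameter [c] replaces the square root of the variance. *)
Lemma expect_frontier_dev st c : st.2 \subset st.1 -> 0 < c ->
  EE (fun G => `|#|frontier G st|%:R - D * #|st.2|%:R|) <=
  (D * #|st.2|%:R / c + c) / 2 + D * q * #|st.2|%:R ^+ 2 +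
  q * (#|st.1|%:R * #|st.2|%:R).
Proof.
move=> sub c0; have var := variance_frontier sub; have m1 := expect_frontier_le sub.
rewrite (expect_frontier sub) in m1.
have /andP[p1 p2] := onem_pow_ge q01 #|st.2|.
have q0 : 0 <= q by case/andP: q01.
(* The mean falls short of [D * #|st.2|] because some vertices have several neighbours in the sphere
   (quadratic term) and because the ball is no longer available. *)
have bias : D * #|st.2|%:R - #|~: st.1|%:R * reach #|st.2| <=
    D * q * #|st.2|%:R ^+ 2 + q * (#|st.1|%:R * #|st.2|%:R).
  have -> : #|~: st.1|%:R = #|T|%:R - #|st.1|%:R :> R.
    by rewrite -(cardsC st.1) natrD addrAC subrr add0r.
  rewrite -/(reach _) in p1 p2; rewrite mulrBl.
  have h1 : #|T|%:R * (#|st.2|%:R * q - (#|st.2|%:R * q) ^+ 2) <= #|T|%:R * reach #|st.2|.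
    by rewrite ler_wpM2l ?ler0n.
  have h2 : #|st.1|%:R * reach #|st.2| <= #|st.1|%:R * (#|st.2|%:R * q).
    by rewrite ler_wpM2l ?ler0n.
  rewrite -subr_ge0 in h1; rewrite -subr_ge0 in h2; rewrite -subr_ge0.
  apply: le_trans (addr_ge0 h1 h2) _; rewrite le_eqVlt; apply/orP; left; apply/eqP.
  by ring.
set m := _ * reach _ in var m1 bias *.
apply: (@le_trans _ _ (EE (fun G => (c^-1 / 2) * (#|frontier G st|%:R - m) ^+ 2 +
   (c / 2 + (D * #|st.2|%:R - m))))).
  apply: le_expect => // G _; set x : R := #|frontier G st|%:R.
  have : `|x - D * #|st.2|%:R| <= `|x - m| + (D * #|st.2|%:R - m).
    rewrite -[X in _ <= _ + X]ger0_norm ?subr_ge0 // distrC.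
    rewrite -[X in _ <= X]addrC [`|x - m|]distrC; apply: le_trans (ler_normD _ _).
    by rewrite subrKA.
  suff : `|x - m| <= c^-1 / 2 * (x - m) ^+ 2 + c / 2 by lra.
  rewrite -(ger0_norm (sqr_ge0 (x - m))) normrX; set y := `|x - m|.
  have -> : c^-1 / 2 * y ^+ 2 + c / 2 = y + c^-1 / 2 * (y - c) ^+ 2 by field; lra.
  by rewrite lerDl mulr_ge0 ?sqr_ge0 // divr_ge0 ?invr_ge0 ?(ltW c0).
rewrite expectD expectZ expect_cst.
have : c^-1 / 2 * EE (fun G => (#|frontier G st|%:R - m) ^+ 2) <= c^-1 / 2 * (D * #|st.2|%:R).
  rewrite ler_wpM2l ?divr_ge0 ?invr_ge0 ?(ltW c0) //; exact: le_trans var m1.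
have -> : c^-1 / 2 * (D * #|st.2|%:R) = D * #|st.2|%:R / c / 2 by ring.
by rewrite mulrDl; lra.
Qed.

End Exploration.

(** * Moments of ball and sphere sizes *)

Section SphereMoments.
Local Open Scope ring_scope.
Variables (R : realType) (T : finType) (r : T) (q : R).
Hypothesis q01 : 0 <= q <= 1.
Implicit Types (G : edge_set T) (st : {set T} * {set T}).
Local Notation EE := (expect (all_edges T) q).
Local Notation D := (#|T|%:R * q).
Let q0 : 0 <= q. Proof. by case/andP: q01. Qed.

Local Notation s d G := (#|(bfs G r d).2|%:R).
Local Notation b d G := (#|(bfs G r d).1|%:R).

(** The conditional estimates hold only at typical states. The indicator of such states is a
    function of the state, so it passes through the conditioning. *)
Lemma bfs_markov_le d (good : pred ({set T} * {set T}))
    (F : {set T} * {set T} -> edge_set T -> R) beta : 0 <= beta ->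
  (forall st, st.2 \subset st.1 -> depends_on (~: touched st) (F st)) ->
  (forall st, st.2 \subset st.1 -> good st -> EE (F st) <= beta) ->
  EE (fun G => (good (bfs G r d))%:R * F (bfs G r d) G) <= beta.
Proof.
move=> b0 dep bnd; rewrite (@bfs_markov _ _ _ _ _ (fun st G => (good st)%:R * F st G)).
  rewrite -[X in _ <= X](expect_cst (all_edges T) q).
  apply: le_expect => // G _; rewrite expectZ; case: (boolP (good _)) => g.
    by rewrite mul1r bnd // sphere_sub_ball.
  by rewrite mul0r.
by move=> st sub G; rewrite dep.
Qed.

Lemma expect_bfsS d (h : {set T} * {set T} -> {set T} -> R) :
  EE (fun G => h (bfs G r d) (bfs G r d.+1).2) =
  EE (fun G => EE (fun G' => h (bfs G r d) (frontier G' (bfs G r d)))).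
Proof.
rewrite -(@bfs_markov _ _ _ _ _ (fun st G => h st (frontier G st))) //.
by move=> st sub G; rewrite (frontier_depends sub).
Qed.

Lemma expect_sphere d : EE (fun G => s d G) <= D ^+ d.
Proof.
elim: d => [|d IH].
  rewrite expr0 -[X in _ <= X](expect_cst (all_edges T) q); apply: le_expect => // G _.
  by rewrite cards1.
rewrite (expect_bfsS _ (fun _ S => #|S|%:R)) exprS.
apply: le_trans (ler_wpM2l (mean_deg_ge0 T q01) IH); rewrite -expectZ.
apply: le_expect => // G _; apply: expect_frontier_le => //.
exact: sphere_sub_ball.
Qed.

Lemma expect_ball d : 2 <= D -> EE (fun G => b d G) <= 2 * D ^+ d.
Proof.
move=> D2; elim: d => [|d IH].
  rewrite expr0 -[X in _ <= X](expect_cst (all_edges T) q); apply: le_expect => // G _.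
  by rewrite cards1; lra.
rewrite (@eq_expect _ _ _ _ _ (fun G => b d G + s d.+1 G)); last first.
  by move=> G _; rewrite card_ballS natrD.
rewrite expectD; have := expect_sphere d.+1; rewrite exprS.
have : 2 * D ^+ d <= D * D ^+ d by rewrite ler_wpM2r ?exprn_ge0 ?mean_deg_ge0.
by lra.
Qed.

(** The subtracted [D ^+ d] closes the induction: multiplied by [D^2], it pays for the variance term
    [D * D ^+ d] and leaves the new [D ^+ d.+1], as [D >= 2]. *)
Lemma expect_sphere_sqr d : 2 <= D ->
  EE (fun G => s d G ^+ 2) <= 2 * D ^+ d ^+ 2 - D ^+ d.
Proof.
move=> D2; elim: d => [|d IH].
  rewrite expr0 -[X in _ <= X](expect_cst (all_edges T) q); apply: le_expect => // G _.
  by rewrite cards1 expr1n; lra.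
rewrite (expect_bfsS _ (fun _ S => #|S|%:R ^+ 2)).
apply: (@le_trans _ _ (EE (fun G => D * s d G + D ^+ 2 * s d G ^+ 2))).
  by apply: le_expect => // G _; apply: expect_frontier_sqr_le => //; exact: sphere_sub_ball.
rewrite expectD !expectZ.
have h1 := ler_wpM2l (mean_deg_ge0 T q01) (expect_sphere d).
have h2 := ler_wpM2l (sqr_ge0 D) IH.
apply: le_trans (lerD h1 h2) _; rewrite [D ^+ d.+1]exprS; set x := D ^+ d.
have x0 : 0 <= x by rewrite exprn_ge0 ?mean_deg_ge0.
have : 2 * (D * x) <= D * (D * x) by rewrite ler_wpM2r ?mulr_ge0 ?ler0n ?q0.
by rewrite !expr2; lra.
Qed.

Lemma expect_ball_sphere d : 2 <= D ->
  EE (fun G => b d G * s d G) <= 4 * D ^+ d ^+ 2.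
Proof.
move=> D2; elim: d => [|d IH].
  rewrite expr0 -[X in _ <= X](expect_cst (all_edges T) q); apply: le_expect => // G _.
  by rewrite cards1 expr1n; lra.
rewrite (@eq_expect _ _ _ _ _ (fun G => b d G * s d.+1 G + s d.+1 G ^+ 2)); last first.
  by move=> G _; rewrite card_ballS natrD mulrDl expr2.
rewrite (expect_bfsS _ (fun st S => #|st.1|%:R * #|S|%:R + #|S|%:R ^+ 2)).
apply: (@le_trans _ _ (EE (fun G => D * (b d G * s d G) + (D * s d G + D ^+ 2 * s d G ^+ 2)))).
  apply: le_expect => // G _; rewrite expectD expectZ; apply: lerD.
    rewrite mulrCA ler_wpM2l ?ler0n //; apply: expect_frontier_le => //.
    exact: sphere_sub_ball.
  by apply: expect_frontier_sqr_le => //; exact: sphere_sub_ball.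
rewrite !expectD !expectZ.
have h0 := ler_wpM2l (mean_deg_ge0 T q01) IH.
have h1 := ler_wpM2l (mean_deg_ge0 T q01) (expect_sphere d).
have h2 := ler_wpM2l (sqr_ge0 D) (expect_sphere_sqr d D2).
apply: le_trans (lerD h0 (lerD h1 h2)) _; rewrite [D ^+ d.+1]exprS; set x := D ^+ d.
have x0 : 0 <= x by rewrite exprn_ge0 ?mean_deg_ge0.
have : 2 * (D * x) <= D * (D * x) by rewrite ler_wpM2r ?mulr_ge0 ?ler0n ?q0.
have : 2 * (D * x * x) <= D * (D * x * x) by rewrite ler_wpM2r ?mulr_ge0 ?ler0n ?q0.
have : 0 <= D * x by rewrite ?mulr_ge0 ?ler0n ?q0.
by rewrite !expr2; lra.
Qed.

(** Generation [j] adds a fluctuation of order [rho^j], the root of its mean, which is then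
    multiplied by [D] at each step; the geometric sum is of order [D^d / rho]. Subtracting
    [rho ^+ d] leaves room for the newest fluctuation. The second term sums the losses to collisions
    and to the ball. *)
Lemma expect_sphere_dev d rho : 2 <= rho -> D = rho ^+ 2 ->
  EE (fun G => `|s d G - D ^+ d|) <=
  2 / rho * (D ^+ d - rho ^+ d) + 6 * (q / D) * D ^+ d ^+ 2.
Proof.
move=> rho2 DE; have D4 : 4 <= D by rewrite DE expr2; nra.
elim: d => [|d IH].
  rewrite !expr0 expr1n subrr mulr0 add0r mulr1.
  apply: (@le_trans _ _ 0); last by rewrite mulr_ge0 // divr_ge0 //; lra.
  rewrite -[X in _ <= X](expect_cst (all_edges T) q); apply: le_expect => // G _.
  by rewrite cards1 subrr normr0.
(* The AM-GM parameter is the square root of the variance bound [D ^+ d.+1], which balances the two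
   terms. *)
pose c := rho ^+ d.+1; have c0 : 0 < c by rewrite exprn_gt0 //; lra.
have cc : c * c = D ^+ d.+1 by rewrite DE /c -expr2 exprAC.
apply: (@le_trans _ _ (EE (fun G => `|s d.+1 G - D * s d G|) +
    D * EE (fun G => `|s d G - D ^+ d|))).
  rewrite -expectZ -expectD; apply: le_expect => // G _.
  rewrite -[X in _ <= _ + X * _]ger0_norm ?mean_deg_ge0 // -normrM mulrBr -exprS.
  by apply: le_trans (ler_normD _ _); rewrite subrKA.
have h1 : EE (fun G => `|s d.+1 G - D * s d G|) <= c + 3 * q * D * D ^+ d ^+ 2.
  rewrite (expect_bfsS _ (fun st S => `|#|S|%:R - D * #|st.2|%:R|)).
  apply: (@le_trans _ _ (EE (fun G => (D * s d G / c + c) / 2 +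
      D * q * s d G ^+ 2 + q * (b d G * s d G)))).
    apply: le_expect => // G _; apply: expect_frontier_dev => //.
    exact: sphere_sub_ball.
  rewrite !expectD !expectZr !expectD !expectZr expect_cst !expectZ.
  have g1 : D * EE (fun G => s d G) / c <= c.
    rewrite ler_pdivrMr // cc exprS.
    by apply: ler_wpM2l; [exact: mean_deg_ge0|exact: expect_sphere].
  have D2 : 2 <= D by lra.
  have g2 := ler_wpM2l (mulr_ge0 (mean_deg_ge0 T q01) q0) (expect_sphere_sqr d D2).
  have g3 := ler_wpM2l q0 (expect_ball_sphere d D2).
  have x0 : 0 <= D ^+ d by rewrite exprn_ge0 ?mean_deg_ge0.
  have g4 : 4 * (q * D ^+ d ^+ 2) <= D * (q * D ^+ d ^+ 2).
    by rewrite ler_wpM2r ?mulr_ge0 ?exprn_ge0 ?mulr_ge0 ?ler0n ?q0.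
  have g5 : 0 <= D * q * D ^+ d by rewrite ?mulr_ge0 ?ler0n ?q0.
  set e1 := EE _ in g1 *; set e2 := EE _ in g2 *; set e3 := EE _ in g3 *.
  set x := D ^+ d ^+ 2 in g2 g3 g4 *; set y := D * e1 / c in g1 *.
  by move: g1 g2 g3 g4 g5; rewrite mulrBr; lra.
have h2 := ler_wpM2l (mean_deg_ge0 T q01) IH.
apply: le_trans (lerD h1 h2) _; rewrite /c [D ^+ d.+1]exprS [rho ^+ d.+1]exprS.
set x := D ^+ d; set y := rho ^+ d.
have y0 : 0 <= y by rewrite exprn_ge0 //; lra.
have k1 : rho * y + 2 / rho * (D * (x - y)) <= 2 / rho * (D * x - rho * y).
  have -> : 2 / rho * (D * (x - y)) = 2 / rho * (D * x - rho * y) + 2 * y - 2 * (rho * y).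
    by rewrite DE; field; lra.
  by have := ler_wpM2r y0 rho2; lra.
have k2 : 3 * q * D * x ^+ 2 + D * (6 * (q / D) * x ^+ 2) <= 6 * (q / D) * (D * x) ^+ 2.
  move: D4; set Dv := D => D4.
  have -> : Dv * (6 * (q / Dv) * x ^+ 2) = 6 * (q * x ^+ 2) by field; lra.
  have -> : 6 * (q / Dv) * (Dv * x) ^+ 2 = 6 * (Dv * (q * x ^+ 2)) by field; lra.
  have : 4 * (q * x ^+ 2) <= Dv * (q * x ^+ 2).
    by rewrite ler_wpM2r // mulr_ge0 ?sqr_ge0 ?q0.
  have : 0 <= q * x ^+ 2 by rewrite mulr_ge0 ?sqr_ge0 ?q0.
  have -> : 3 * q * Dv * x ^+ 2 = 3 * (Dv * (q * x ^+ 2)) by ring.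
  by set z := q * x ^+ 2; set w := Dv * z; lra.
by move: k1 k2; rewrite mulrDr; lra.
Qed.

End SphereMoments.

(** * [Psi0] as a series *)

Section PoissonSeries.
Local Open Scope ring_scope.
Local Open Scope classical_set_scope.
Variable R : realType.

Lemma poisson_integral (mu : R) (f : nat -> R) : 0 < mu -> (forall j, 0 <= f j) ->
  (\int[poisson_prob mu 0]_w (f w)%:E =
   \sum_(0 <= j <oo) (poisson_pmf mu j * f j)%:E)%E.
Proof.
move=> mu0 f0.
pose m_ (k : nat) : {measure set nat -> \bar R} :=
  mscale (NngNum (poisson_pmf_ge0 mu k)) \d_k.
have f0' : (forall t : nat, setT t -> 0 <= (f t)%:E)%E by move=> t _; rewrite lee_fin.
have mf : measurable_fun (@setT nat) (EFin \o f) by [].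
rewrite (eq_measure_integral (mseries m_ 0)).
  rewrite ge0_integral_measure_series //; apply: eq_eseriesr => k _.
  rewrite /m_ ge0_integral_mscale // integral_dirac // diracT mul1e.
  by rewrite -EFinM.
move=> A _ _; rewrite /= /poisson_prob mu0 /mseries.
rewrite esum_mkcond -nneseries_esumT; last first.
  by move=> k; case: ifP => _ //; rewrite lee_fin poisson_pmf_ge0.
apply: eq_eseriesr => k _; rewrite /m_ /=.
transitivity ((poisson_pmf mu k)%:E * \d_k A)%E => //.
by rewrite diracE; case: (k \in A); rewrite ?mule1 ?mule0.
Qed.

(** Since [fine] sends an infinite expectation to 0, finiteness must come first; it follows from the
    uniform bound [c]. *)
Lemma Psi0_partial_sums (mu c : R) : 0 < mu ->
  (forall N, \sum_(0 <= j < N) poisson_pmf mu j * lnmax1 R j <= c) ->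
  Psi0 (expR (- mu)) <= c /\
  forall N, \sum_(0 <= j < N) poisson_pmf mu j * lnmax1 R j <= Psi0 (expR (- mu)).
Proof.
move=> mu0 bnd; rewrite /Psi0.
have -> : ln (1 / expR (- mu)) = mu by rewrite div1r expRN invrK expRK.
rewrite unlock (poisson_integral (f := lnmax1 R) mu0 (@lnmax1_ge0 R)).
have t0 j : (0 <= (poisson_pmf mu j * lnmax1 R j)%:E)%E.
  by rewrite lee_fin mulr_ge0 ?poisson_pmf_ge0 ?lnmax1_ge0.
set e := limn _.
have e1 : (e <= c%:E)%E.
  apply: lime_le; first exact: is_cvg_nneseries.
  by apply: nearW => N; rewrite sumEFin lee_fin.
have e2 N : ((\sum_(0 <= j < N) poisson_pmf mu j * lnmax1 R j)%:E <= e)%E.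
  by rewrite -sumEFin; apply: nneseries_lim_ge.
have ef : e \is a fin_num.
  rewrite ge0_fin_numE; first exact: le_lt_trans e1 (ltry _).
  by apply: le_trans (e2 0%N); rewrite big_nil.
by split=> [|N]; rewrite -lee_fin fineK.
Qed.

End PoissonSeries.

(** * Poisson approximation of binomial means *)

Section PoissonApproximation.
Local Open Scope ring_scope.
Local Open Scope classical_set_scope.
Variables (R : realType) (q : R).
Hypothesis q01 : 0 <= q <= 1.
Local Notation bm := (binomial_mean q).

Lemma binomial_meanE s (g : nat -> R) :
  bm s g = \sum_(0 <= j < s.+1) 'C(s, j)%:R * q ^+ j * (1 - q) ^+ (s - j) * g j.
Proof.
elim: s g => [|s IH] g; first by rewrite big_nat1 bin0 !expr0 !mul1r.
rewrite /= !IH big_nat_recl // [X in _ * X + _]big_nat_recl //=.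
have -> : \sum_(0 <= i < s.+1) 'C(s.+1, i.+1)%:R * q ^+ i.+1 *
      (1 - q) ^+ (s.+1 - i.+1) * g i.+1 =
    q * (\sum_(0 <= i < s.+1) 'C(s, i)%:R * q ^+ i * (1 - q) ^+ (s - i) * g i.+1) +
    \sum_(0 <= i < s.+1) 'C(s, i.+1)%:R * q ^+ i.+1 * (1 - q) ^+ (s - i) * g i.+1.
  rewrite mulr_sumr -big_split /=; apply: eq_bigr => i _.
  by rewrite binS natrD subSS exprS; ring.
have -> : \sum_(0 <= i < s.+1) 'C(s, i.+1)%:R * q ^+ i.+1 * (1 - q) ^+ (s - i) * g i.+1 =
   (1 - q) * \sum_(0 <= i < s) 'C(s, i.+1)%:R * q ^+ i.+1 * (1 - q) ^+ (s - i.+1) * g i.+1.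
  rewrite big_nat_recr //= bin_small // !mul0r addr0 mulr_sumr !big_nat.
  apply: eq_bigr => i /andP[_ li].
  by rewrite -[(s - i)%N]prednK ?subn_gt0 // [(1 - q) ^+ _.+1]exprS -subnS; ring.
by rewrite !bin0 !subn0 exprS; ring.
Qed.

Lemma bin_le_pow s j : 'C(s, j)%:R <= s%:R ^+ j / j`!%:R :> R.
Proof.
rewrite ler_pdivlMr ?ltr0n ?fact_gt0 // -natrM bin_ffact -natrX ler_nat.
elim: j s => [|j IH] s; first by rewrite ffactn0.
case: s => [|s]; first by rewrite ffact0n.
rewrite ffactSS expnS leq_mul // (leq_trans (IH s)) //.
by case: j {IH} => // j; rewrite leq_exp2r.
Qed.

Lemma onem_le_expR : 1 - q <= expR (- q).
Proof. exact: expR_ge1Dx. Qed.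

(** Here [(1 - q)^(s - j) <= exp(- q (s - j))], and [mu <= (s + 1) q] bounds the exponent by
    [- mu + q (j + 1)]; rounding [mu / q] to an integer accounts for the extra [q]. *)
Lemma binomial_pmf_le s j mu : (j <= s)%N -> 0 < mu ->
  s%:R * q <= mu <= s.+1%:R * q ->
  'C(s, j)%:R * q ^+ j * (1 - q) ^+ (s - j) <=
  poisson_pmf mu j * expR (q * j.+1%:R).
Proof.
move=> js mu0 /andP[mu1 mu2]; have [q0 q1] := andP q01.
rewrite /poisson_pmf mu0 -[X in _ <= X]mulrA -expRD.
apply: ler_pM; rewrite ?mulr_ge0 ?ler0n ?exprn_ge0 ?subr_ge0 //.
  apply: le_trans (ler_wpM2r (exprn_ge0 _ q0) (bin_le_pow s j)) _.
  rewrite mulrAC -exprMn ler_wpM2r ?invr_ge0 ?ler0n // lerXn2r // ?nnegrE ?(ltW mu0) //.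
  by rewrite mulr_ge0 ?ler0n.
apply: (@le_trans _ _ (expR (- q) ^+ (s - j))).
  by rewrite lerXn2r ?nnegrE ?subr_ge0 ?expR_ge0 ?onem_le_expR.
rewrite -expRM_natl ler_expR natrB //.
by move: mu2; rewrite -!natr1; lra.
Qed.

Lemma sum_id_exp_coeff (x : R) N :
  \sum_(0 <= j < N.+1) j%:R * (x ^+ j / j`!%:R) = x * series (exp_coeff x) N.
Proof.
rewrite big_nat_recl // mul0r add0r /series /= mulr_sumr; apply: eq_bigr => j _.
rewrite factS natrM invfM exprS /exp_coeff /=.
have jn0 : j.+1%:R != 0 :> R by rewrite pnatr_eq0.
have fn0 : j`!%:R != 0 :> R by rewrite pnatr_eq0 -lt0n fact_gt0.
move: jn0 fn0; set a := j.+1%:R; set c := j`!%:R => a0 c0.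
by field; do ?[apply/andP; split].
Qed.

(** This is the closed form of the mean of [X (exp(q (X + 1)) - 1)] for [X] Poisson of mean [mu]. *)
Definition poisson_error (mu : R) : R :=
  mu * (expR (2 * q + mu * (expR q - 1)) - 1).

Lemma sum_poisson_error mu N : 0 < mu ->
  \sum_(0 <= j < N) j%:R * (poisson_pmf mu j * (expR (q * j.+1%:R) - 1))
  <= poisson_error mu.
Proof.
move=> mu0; have [q0 q1] := andP q01.
pose t j : R := j%:R * (poisson_pmf mu j * (expR (q * j.+1%:R) - 1)).
have t0 j : 0 <= t j.
  rewrite mulr_ge0 ?ler0n // mulr_ge0 ?poisson_pmf_ge0 // subr_ge0.
  by rewrite -expR0 ler_expR mulr_ge0 ?ler0n.
apply: (@le_trans _ _ (\sum_(0 <= j < N.+1) t j)).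
  by rewrite big_nat_recr //= lerDl.
pose u N := mu * expR (- mu) * (expR (2 * q) * series (exp_coeff (mu * expR q)) N
   - series (exp_coeff mu) N).
have uE M : \sum_(0 <= j < M.+1) t j = u M.
  have tE j : t j = expR (- mu) * (expR q * (j%:R * ((mu * expR q) ^+ j / j`!%:R)))
      - expR (- mu) * (j%:R * (mu ^+ j / j`!%:R)).
    rewrite /t /poisson_pmf mu0 -[j.+1%:R]natr1 (mulrDr q) mulr1 expRD exprMn -expRM_natr.
    by ring.
  under eq_bigr do rewrite tE.
  rewrite sumrB -!mulr_sumr !sum_id_exp_coeff /u.
  have -> : expR (2 * q) = expR q * expR q by rewrite -expRD; congr expR; ring.
  by ring.
have cu : u @ \oo --> poisson_error mu.
  have -> : poisson_error mu = mu * expR (- mu) *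
      (expR (2 * q) * expR (mu * expR q) - expR mu).
    rewrite /poisson_error mulrBr [RHS]mulrBr -!mulrA -!expRD addNr expR0.
    by congr (_ * expR _ - _); ring.
  apply: cvgM; first exact: cvg_cst.
  apply: cvgB; last exact: is_cvg_series_exp_coeff.
  by apply: cvgM; [exact: cvg_cst|exact: is_cvg_series_exp_coeff].
rewrite uE -(cvg_lim (@Rhausdorff R) cu); apply: nondecreasing_cvgn_le.
  apply/nondecreasing_seqP => M; rewrite -!uE [X in _ <= X]big_nat_recr //=.
  by rewrite lerDl.
by apply/cvg_ex; exists (poisson_error mu).
Qed.

Lemma sum_poisson_mean (mu : R) N : 0 < mu ->
  \sum_(0 <= j < N) poisson_pmf mu j * j%:R <= mu.
Proof.
move=> mu0.
have p0 j : 0 <= poisson_pmf mu j * j%:R by rewrite mulr_ge0 ?poisson_pmf_ge0 ?ler0n.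
apply: (@le_trans _ _ (\sum_(0 <= j < N.+1) poisson_pmf mu j * j%:R)).
  by rewrite big_nat_recr //= lerDl.
have -> : \sum_(0 <= j < N.+1) poisson_pmf mu j * j%:R =
    expR (- mu) * \sum_(0 <= j < N.+1) j%:R * (mu ^+ j / j`!%:R).
  by rewrite mulr_sumr; apply: eq_bigr => j _; rewrite /poisson_pmf mu0; ring.
rewrite sum_id_exp_coeff mulrCA -[X in _ <= X]mulr1 ler_wpM2l ?(ltW mu0) //.
rewrite -(expR0 R) -(addNr mu) expRD ler_wpM2l ?expR_ge0 //.
apply: nondecreasing_cvgn_le; last exact: is_cvg_series_exp_coeff.
by apply: nondecreasing_series => j _ _; rewrite exp_coeff_ge0 // ltW.
Qed.

(* Only a pointwise upper bound on the binomial weights is needed: it is used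
   once with [g] and once with [j - g j]. *)
Lemma binomial_le_poisson s mu (g : nat -> R) N : (s < N)%N -> 0 < mu ->
  s%:R * q <= mu <= s.+1%:R * q -> (forall j, 0 <= g j <= j%:R) ->
  bm s g <= \sum_(0 <= j < N) poisson_pmf mu j * g j + poisson_error mu.
Proof.
move=> sN mu0 mus gj; have q0 : 0 <= q by case/andP: q01.
apply: (@le_trans _ _ (\sum_(0 <= j < s.+1) (poisson_pmf mu j * g j +
    j%:R * (poisson_pmf mu j * (expR (q * j.+1%:R) - 1))))).
  rewrite binomial_meanE !big_nat; apply: ler_sum => j /andP[_]; rewrite ltnS => js.
  have /andP[g0 g1] := gj j.
  apply: le_trans (ler_wpM2r g0 (binomial_pmf_le js mu0 mus)) _.
  have e1 : 0 <= poisson_pmf mu j * (expR (q * j.+1%:R) - 1).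
    by rewrite mulr_ge0 ?poisson_pmf_ge0 // subr_ge0 -expR0 ler_expR mulr_ge0 ?ler0n.
  by have := ler_wpM2r e1 g1; lra.
rewrite big_split /=; apply: lerD; last exact: sum_poisson_error.
rewrite [X in _ <= X](big_cat_nat _ (n := s.+1)) //= lerDl sumr_ge0 // => j _.
by rewrite mulr_ge0 ?poisson_pmf_ge0 //; case/andP: (gj j).
Qed.

Lemma binomial_Psi0 s mu : 0 < mu -> s%:R * q <= mu <= s.+1%:R * q ->
  `|bm s (lnmax1 R) - Psi0 (expR (- mu))| <= q + poisson_error mu.
Proof.
move=> mu0 mus; have q0 : 0 <= q by case/andP: q01.
have f01 j : 0 <= lnmax1 R j <= j%:R by rewrite lnmax1_ge0 lnmax1_le_nat.
have f02 j : 0 <= j%:R - lnmax1 R j <= j%:R.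
  by have := f01 j; lra.
pose c := bm s (lnmax1 R) + q + poisson_error mu.
have bnd N : \sum_(0 <= j < N) poisson_pmf mu j * lnmax1 R j <= c.
  (* An upper bound for [j - f j] becomes a lower bound for [f] once the means [s q] and [mu] are
     removed; these differ by at most [q], the first term of the error. *)
  have := @binomial_le_poisson s mu (fun j => j%:R - lnmax1 R j) (N + s.+1)
    (leq_addl _ _) mu0 mus f02.
  rewrite binomial_meanB binomial_mean_id; under eq_bigr do rewrite mulrBr.
  rewrite sumrB; have := sum_poisson_mean (N + s.+1) mu0.
  have : \sum_(0 <= j < N) poisson_pmf mu j * lnmax1 R j <=
     \sum_(0 <= j < N + s.+1) poisson_pmf mu j * lnmax1 R j.
    rewrite [X in _ <= X](big_cat_nat _ (n := N)) ?leq_addr //= lerDl sumr_ge0 // => j _.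
    by rewrite mulr_ge0 ?poisson_pmf_ge0 ?lnmax1_ge0.
  by move: mus; rewrite /c -natr1 mulrDl mul1r; lra.
have [h1 h2] := Psi0_partial_sums mu0 bnd.
have := binomial_le_poisson (ltnSn s) mu0 mus f01.
have := h2 s.+1; move: h1; rewrite /c ler_norml; lra.
Qed.

End PoissonApproximation.

(** * Elementary exponential estimates *)

Section ExponentialEstimates.
Local Open Scope ring_scope.
Variable R : realType.
Implicit Types (x y c mu eps q : R).

(* The tangent line of [expR] at [- (c * mu)], taken at [- mu] and at [0]. *)
Lemma onem_expR_scale_ge c mu : 0 <= c <= 1 ->
  c * (1 - expR (- mu)) <= 1 - expR (- (c * mu)).
Proof.
move=> /andP[c0 c1]; set a := expR (- (c * mu)).
have a0 : 0 <= a := expR_ge0 _.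
have h1 : a * (1 - mu * (1 - c)) <= expR (- mu).
  have -> : - mu = - (c * mu) + (- (mu * (1 - c))) by ring.
  by rewrite expRD ler_wpM2l // expR_ge1Dx.
have h2 : a * (1 + c * mu) <= 1.
  rewrite -[leRHS](expR0 R) -(addNr (c * mu)) expRD.
  by rewrite ler_wpM2l // expR_ge1Dx.
have h3 := ler_wpM2l c0 h1.
have c1' : 0 <= 1 - c by lra.
have h4 := ler_wpM2l c1' h2.
have -> : a = c * (a * (1 - mu * (1 - c))) + (1 - c) * (a * (1 + c * mu)) by ring.
by rewrite mulrBr; lra.
Qed.

Lemma onem_expR_scale_le c mu : 1 <= c ->
  1 - expR (- (c * mu)) <= c * (1 - expR (- mu)).
Proof.
move=> c1; have c0 : 0 < c by lra.
have := @onem_expR_scale_ge c^-1 (c * mu); rewrite invr_ge0 (ltW c0) invf_le1 // c1.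
by move=> /(_ isT); rewrite mulKf ?gt_eqF // ler_pdivrMl.
Qed.

Lemma onem_expR_ge x : 0 <= x <= 1 -> x / 2 <= 1 - expR (- x).
Proof.
move=> /andP[x0 x1]; have := @onem_expR_scale_ge x 1; rewrite x0 x1 mulr1 => /(_ isT).
have e2 : expR (-1) <= 2^-1 :> R.
  by rewrite expRN lef_pV2 ?posrE ?expR_gt0 //; have := expR_ge1Dx (1 : R); lra.
have := ler_wpM2l x0 e2; rewrite mulrBr; lra.
Qed.

Lemma expR_sub1_le x : 0 <= x <= 1 / 2 -> expR x - 1 <= 2 * x.
Proof.
move=> /andP[x0 x1]; have := expR_ge1Dx (- x); rewrite expRN => h.
have e0 := expR_gt0 x.
have : (1 - x) * expR x <= 1.
  by rewrite -[leRHS](mulVf (lt0r_neq0 e0)) ler_pM2r.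
by move: e0; set e := expR x; nra.
Qed.

(** The error is relative since [1 - exp(- x q)] may be small. Concavity of [1 - exp(-t)] carries a
    relative error on [s] over to the value, and [4 * q <= eps] absorbs the gap between [ln (1 - q)]
    and [- q]. *)
Lemma reach_approx q (s : nat) x eps : 0 < q -> 0 <= eps <= 1 -> 4 * q <= eps ->
  0 <= x -> `|s%:R - x| <= eps * x ->
  `|reach q s - (1 - expR (- (x * q)))| <= 2 * eps * (1 - expR (- (x * q))).
Proof.
move=> q0 /andP[e0 e1] qe x0; rewrite ler_distl => /andP[s1 s2].
have q1 : q <= 1 / 4 by lra.
set mu := x * q; have mu0 : 0 <= mu by rewrite mulr_ge0 // ltW.
set A := 1 - expR (- mu).
have A0 : 0 <= A by rewrite subr_ge0 -(expR0 R) ler_expR; lra.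
have lo : (1 - eps) * A <= reach q s.
  apply: le_trans (onem_expR_scale_ge mu _) _; first by lra.
  rewrite /reach lerD2l lerN2.
  apply: (@le_trans _ _ (expR (- q) ^+ s)).
    by rewrite lerXn2r ?nnegrE ?expR_ge0 ?expR_ge1Dx //; lra.
  rewrite -expRM_natl ler_expR; have := ler_wpM2r (ltW q0) s1.
  by rewrite /mu mulrBl mulrN; lra.
have hi : reach q s <= (1 + 2 * eps) * A.
  apply: le_trans (onem_expR_scale_le mu _); last by lra.
  rewrite /reach lerD2l lerN2.
  have qq : - (q * (1 + 2 * q)) <= ln (1 - q).
    apply: le_trans (ln_ge_1subrV _); last by lra.
    have : (1 - q)^-1 <= 1 + q * (1 + 2 * q) .
      by rewrite -[X in X <= _]mul1r ler_pdivrMr; nra.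
    by lra.
  apply: (@le_trans _ _ (expR (- (q * (1 + 2 * q))) ^+ s)); last first.
    rewrite lerXn2r ?nnegrE ?expR_ge0 //; first by lra.
    by rewrite -[X in _ <= X]lnK ?posrE ?ler_expR //; lra.
  rewrite -expRM_natl ler_expR mulrN lerN2.
  apply: (@le_trans _ _ ((x + eps * x) * (q * (1 + 2 * q)))).
    by rewrite ler_wpM2r ?mulr_ge0 //; lra.
  have -> : (x + eps * x) * (q * (1 + 2 * q)) = (1 + eps) * (1 + 2 * q) * mu.
    by rewrite /mu; ring.
  by rewrite ler_wpM2r //; nra.
rewrite ler_distl; apply/andP; split; first by nra.
by nra.
Qed.

End ExponentialEstimates.

(** * Concentration at a fixed size *)

Section Concentration.
Local Open Scope ring_scope.
Variables (R : realType) (T : finType) (r : T) (q u : R) (k : nat).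
Implicit Types (G : edge_set T) (st : {set T} * {set T}).
Local Notation EE := (expect (all_edges T) q).
Local Notation N := (#|T|%:R : R).
Local Notation D := (N * q).
Local Notation f := (lnmax1 R).
Hypothesis q_gt0 : 0 < q.
Hypothesis u_gt0 : 0 < u.
Hypothesis u_le : u <= 1 / 10.
Hypothesis D_ge : 1 <= u ^+ 12 * D.
Hypothesis N_ge : D ^+ 4 <= N.
Hypothesis Dk_le : D ^+ k <= u ^+ 4 * N.
Hypothesis Dk_ge : u ^+ 4 * N <= D ^+ k.+1.

(* In terms of the paper, with [d* = k + 1]: [u = (log log n)^(-1/2)],
   [spread = log (1 / lambda)], [covered = 1 - lambda], and [backdeg] is the
   typical number of parents of a vertex at distance [k + 2]. *)
Definition spread : R := D ^+ k * q.
Definition covered : R := 1 - expR (- spread).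
Definition backdeg : R := D * covered.
Local Notation mu := spread.
Local Notation A := covered.
Local Notation m := backdeg.

Lemma card_gt0R : 0 < N.
Proof. by rewrite ltr0n; apply/card_gt0P; exists r. Qed.
#[local] Hint Resolve card_gt0R : core.

Lemma avg_deg_gt0 : 0 < D. Proof. exact: mulr_gt0. Qed.
#[local] Hint Resolve avg_deg_gt0 : core.

Lemma scaleX_le a b : (a <= b)%N -> u ^+ b <= u ^+ a * (1 / 10) ^+ (b - a).
Proof.
move=> ab; rewrite -{1}(subnKC ab) exprD ler_wpM2l ?exprn_ge0 ?(ltW u_gt0) //.
by rewrite lerXn2r ?nnegrE ?(ltW u_gt0) //; lra.
Qed.

Lemma scaleX_avg_deg a : (a <= 12)%N -> 10 ^+ (12 - a) <= u ^+ a * D.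
Proof.
move=> a12; have h := ler_wpM2r (ltW avg_deg_gt0) (scaleX_le a12).
have h1 := le_trans D_ge h.
have p0 : 0 < 10 ^+ (12 - a) :> R by rewrite exprn_gt0.
rewrite -[leLHS]mulr1; apply: le_trans (ler_wpM2l (ltW p0) h1) _.
by rewrite mulrAC expr_div_n expr1n div1r mulrCA divff ?mulr1 // lt0r_neq0.
Qed.

Lemma avg_deg_big : 10 ^+ 12 <= D.
Proof. by have := @scaleX_avg_deg 0 isT; rewrite expr0 mul1r. Qed.

Lemma avg_deg_ge1 : 1 <= D.
Proof. by apply: le_trans avg_deg_big; rewrite exprn_ege1 ?ler1n. Qed.
#[local] Hint Resolve avg_deg_ge1 : core.

Lemma avg_deg_ge4 : 4 <= D.
Proof. by apply: le_trans avg_deg_big; rewrite -natrX ler_nat. Qed.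
#[local] Hint Resolve avg_deg_ge4 : core.

Lemma prob_avg_deg3 : q * D ^+ 3 <= 1.
Proof.
rewrite -(ler_pM2l card_gt0R) mulr1 mulrA -exprS; exact: N_ge.
Qed.

Lemma prob_le : q <= u ^+ 24.
Proof.
have h : 1 <= u ^+ 24 * D ^+ 2.
  by rewrite (exprM u 12 2) -exprMn exprn_ege1.
have h2 : q * D ^+ 2 <= 1.
  apply: le_trans prob_avg_deg3; rewrite ler_wpM2l ?(ltW q_gt0) //.
  exact: ler_weXn2l.
have D2 : 0 < D ^+ 2 by rewrite exprn_gt0.
by rewrite -(ler_pM2r D2); apply: le_trans h2 h.
Qed.

Lemma scaleX_le1 a : u ^+ a <= 1.
Proof. by rewrite exprn_ile1 ?(ltW u_gt0) // (le_trans u_le) //; lra. Qed.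

Lemma scaleX_gt0 a : 0 < u ^+ a. Proof. by rewrite exprn_gt0. Qed.
#[local] Hint Resolve scaleX_gt0 : core.

Lemma scale_ge0 : 0 <= u. Proof. exact: ltW. Qed.
#[local] Hint Resolve scale_ge0 : core.

Lemma scaleX_ge0 a : 0 <= u ^+ a. Proof. by rewrite ltW. Qed.
#[local] Hint Resolve scaleX_ge0 : core.

Lemma prob01 : 0 <= q <= 1.
Proof. by rewrite (ltW q_gt0) (le_trans prob_le) ?scaleX_le1. Qed.
#[local] Hint Resolve prob01 : core.

Lemma spread_le : mu <= u ^+ 4 * D.
Proof. by rewrite /spread mulrA ler_wpM2r // ltW. Qed.

Lemma spread_ge : u ^+ 4 <= mu.
Proof.
by rewrite -(ler_pM2r card_gt0R) (le_trans Dk_ge) // exprS /spread mulrC -mulrA [N * q]mulrC.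
Qed.

Lemma spread_gt0 : 0 < mu. Proof. by apply: lt_le_trans spread_ge; exact: scaleX_gt0. Qed.
#[local] Hint Resolve spread_gt0 : core.

Lemma covered_ge : u ^+ 4 / 2 <= A.
Proof.
apply: (@le_trans _ _ (1 - expR (- u ^+ 4))).
  by apply: onem_expR_ge; rewrite scaleX_le1 ltW ?scaleX_gt0.
by rewrite lerD2l lerN2 ler_expR lerN2 spread_ge.
Qed.
#[local] Hint Resolve covered_ge : core.

Lemma covered_gt0 : 0 < A.
Proof. by apply: lt_le_trans covered_ge; have := scaleX_gt0 4; lra. Qed.
#[local] Hint Resolve covered_gt0 : core.

Lemma covered_le1 : A <= 1. Proof. by have := expR_ge0 (- mu); rewrite /covered; lra. Qed.
#[local] Hint Resolve covered_le1 : core.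

Lemma backdeg_gt0 : 0 < m. Proof. exact: mulr_gt0. Qed.
#[local] Hint Resolve backdeg_gt0 : core.

Lemma backdeg_ge : u ^+ 4 * D / 2 <= m.
Proof.
have -> : u ^+ 4 * D / 2 = D * (u ^+ 4 / 2) by ring.
by rewrite /backdeg ler_pM2l.
Qed.

Lemma avg_degX_gt0 : 0 < D ^+ k. Proof. exact: exprn_gt0. Qed.
#[local] Hint Resolve avg_degX_gt0 : core.

(** In effect [k >= 2]; this makes the rounding of [D ^+ k] to an integer negligible. *)
Lemma avg_degX_ge2 : D ^+ 2 <= D ^+ k.
Proof.
have h : u ^+ 4 * D ^+ 4 <= D * D ^+ k.
  by rewrite -exprS (le_trans _ Dk_ge) // ler_pM2l ?scaleX_gt0.
have h2 : D * D ^+ 2 <= u ^+ 4 * D ^+ 4.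
  rewrite -exprS (exprS D 3) mulrA ler_peMl ?exprn_ge0 ?(ltW avg_deg_gt0) //.
  by apply: le_trans (scaleX_avg_deg _); rewrite // exprn_ege1 // ler1n.
by rewrite -(ler_pM2l avg_deg_gt0); apply: le_trans h2 h.
Qed.

Definition typical_sphere st : bool :=
  (`|#|st.2|%:R - D ^+ k| <= u ^+ 3 * D ^+ k) && (#|st.1|%:R <= u ^+ 3 * N).

Definition typical_next st : bool :=
  `|#|st.2|%:R - N * A| <= 5 * u ^+ 3 * (N * A).

Definition deg_dev G st : R :=
  \sum_(v in ~: st.1) ((deg_in G st.2 v)%:R - m) ^+ 2.

Lemma typical_reach st : typical_sphere st ->
  `|reach q #|st.2| - A| <= 2 * u ^+ 3 * A.
Proof.
move=> /andP[h _]; have := @reach_approx R q #|st.2| (D ^+ k) (u ^+ 3).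
apply => //; [by rewrite scaleX_le1 ltW ?scaleX_gt0| |exact: ltW].
apply: le_trans (ler_wpM2l _ prob_le) _ => //.
have := @scaleX_le 3 24 isT; have := scaleX_gt0 3.
set x := u ^+ 3; set y := (1 / 10) ^+ (24 - 3) => x0 h24.
have y1 : y <= 1 / 10 by rewrite /y exprS ler_piMr ?exprn_ile1 //; lra.
have := ler_wpM2l (ltW x0) y1; set z := x * y in h24 *; lra.
Qed.

(** The right-hand side is a failure probability times a threshold, ready for Markov's inequality;
    the five expectation bounds that follow have the same shape. *)
Lemma expect_typical_sphere :
  EE (fun G => `|#|(bfs G r k).2|%:R - D ^+ k|) <= 7 * u * (u ^+ 3 * D ^+ k).
Proof.
pose rho := Num.sqrt D.
have rho2 : D = rho ^+ 2 by rewrite sqr_sqrtr // ltW.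
have rho0 : 0 < rho by rewrite sqrtr_gt0.
have rhou : 1 <= u ^+ 6 * rho.
  rewrite -(@ler_pXn2r _ 2) ?nnegrE ?mulr_ge0 ?(ltW rho0) //.
  by rewrite expr1n exprMn -rho2 -exprM.
have rho_ge2 : 2 <= rho.
  by rewrite -(@ler_pXn2r _ 2) ?nnegrE ?(ltW rho0) // -rho2 expr2; have := avg_deg_ge4; lra.
apply: le_trans (expect_sphere_dev r prob01 k rho_ge2 rho2) _.
have h1 : 2 / rho * (D ^+ k - rho ^+ k) <= 2 * u ^+ 6 * D ^+ k.
  apply: ler_pM; rewrite ?divr_ge0 ?(ltW rho0) //.
  - rewrite subr_ge0 rho2 -exprM; apply: ler_weXn2l; first by lra.
    by rewrite mul2n -addnn leq_addl.
  - by rewrite ler_pdivrMr // -mulrA ler_peMr.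
  - by rewrite gerBl exprn_ge0 // ltW.
have h2 : 6 * (q / D) * D ^+ k ^+ 2 <= 6 * u ^+ 4 * D ^+ k.
  have -> : q / D = N^-1 by rewrite invfM mulrCA divff ?mulr1 ?lt0r_neq0.
  have -> : 6 * N^-1 * D ^+ k ^+ 2 = 6 * (D ^+ k / N) * D ^+ k by ring.
  by rewrite ler_pM2r // ler_pM2l // ler_pdivrMr.
apply: le_trans (lerD h1 h2) _.
rewrite -mulrDl (mulrA (7 * u)) ler_pM2r //.
have -> : 7 * u * u ^+ 3 = 7 * u ^+ 4 by rewrite -mulrA -exprS.
have := @scaleX_le 4 6 isT; rewrite /=; have := scaleX_gt0 4; lra.
Qed.

Lemma expect_typical_ball :
  EE (fun G => #|(bfs G r k).1|%:R) <= 2 * u * (u ^+ 3 * N).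
Proof.
have D2 : 2 <= D by have := avg_deg_ge4; lra.
apply: le_trans (expect_ball r prob01 k D2) _.
by rewrite -mulrA ler_pM2l // mulrA -exprS.
Qed.

Lemma card_setC_le (B : {set T}) : #|~: B|%:R <= N.
Proof. by rewrite ler_nat max_card. Qed.
#[local] Hint Resolve card_setC_le : core.

(** The variance of a sum of independent indicators is at most its mean, here at most [2 N A]. With
    [A >= u^4 / 2] the claim reduces to [u^11 N >= 4]. *)
Lemma expect_sphere_next :
  EE (fun G => (typical_sphere (bfs G r k))%:R *
      (#|(bfs G r k.+1).2|%:R -
       #|~: (bfs G r k).1|%:R * reach q #|(bfs G r k).2|) ^+ 2)
    <= u * (u ^+ 3 * (N * A)) ^+ 2.
Proof.
have NA0 : 0 < N * A by exact: mulr_gt0.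
apply: (@bfs_markov_le R T r q prob01 k typical_sphere (fun st G =>
    (#|frontier G st|%:R - #|~: st.1|%:R * reach q #|st.2|) ^+ 2)).
- by rewrite mulr_ge0 ?sqr_ge0 ?(ltW u_gt0).
- by move=> st sub G; rewrite (frontier_depends sub).
move=> st sub good; apply: le_trans (variance_frontier prob01 sub) _.
have := typical_reach good; rewrite ler_distl => /andP[_ hr].
apply: (@le_trans _ _ (N * (2 * A))).
  apply: ler_pM; rewrite ?ler0n ?reach_ge0 //; apply: le_trans hr _.
  have := @scaleX_le 0 3 isT; rewrite expr0 /= => u3.
  by have := ler_wpM2r (ltW covered_gt0) u3; have := covered_gt0; lra.
have -> : u * (u ^+ 3 * (N * A)) ^+ 2 = u ^+ 7 * (N * A) * (N * A) by ring.
rewrite mulrCA ler_pM2r //.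
apply: (@le_trans _ _ (u ^+ 7 * (N * (u ^+ 4 / 2)))); last first.
  by rewrite ler_pM2l ?scaleX_gt0 // ler_pM2l.
have -> : u ^+ 7 * (N * (u ^+ 4 / 2)) = u ^+ 11 * N / 2 by ring.
have : u ^+ 11 * D <= u ^+ 11 * N.
  rewrite ler_pM2l ?scaleX_gt0 //; apply: le_trans N_ge.
  by rewrite -{1}[D]expr1; exact: ler_weXn2l.
by have := @scaleX_avg_deg 11 isT; rewrite /= expr1; lra.
Qed.

(** The crude bound [f j <= j] suffices: it gives a variance of at most [2 N D^2], which [D^4 <= N]
    makes small against [u^3 N^2]. *)
Lemma expect_layer :
  EE (fun G => (typical_sphere (bfs G r k))%:R *
      (layer_sum R G (bfs G r k) -
       #|~: (bfs G r k).1|%:R * binomial_mean q #|(bfs G r k).2| f) ^+ 2)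
    <= u * (u * N) ^+ 2.
Proof.
apply: (@bfs_markov_le R T r q prob01 k typical_sphere (fun st G =>
    (layer_sum R G st - #|~: st.1|%:R * binomial_mean q #|st.2| f) ^+ 2)).
- by rewrite mulr_ge0 ?sqr_ge0 ?(ltW u_gt0).
- by move=> st sub G; rewrite /layer_sum (sum_deg_depends f sub).
move=> st sub /andP[good _]; apply: le_trans (variance_sum_deg q f sub) _.
have sq : #|st.2|%:R * q <= D.
  move: good; rewrite ler_distl => /andP[_ good].
  have := ler_wpM2r (ltW q_gt0) good; rewrite mulrDl -mulrA -/mu => h.
  have := @scaleX_le 0 3 isT; rewrite expr0 /= => u3.
  have := ler_wpM2r (ltW spread_gt0) u3.
  have := @scaleX_le 0 4 isT; rewrite expr0 /= => u4.
  have := ler_wpM2r (ltW avg_deg_gt0) u4.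
  by have := spread_le; have := avg_deg_gt0; lra.
have sq0 : 0 <= #|st.2|%:R * q by rewrite mulr_ge0 // ltW.
apply: (@le_trans _ _ (N * (2 * D ^+ 2))).
  apply: ler_pM; rewrite ?ler0n //.
    rewrite -(binomial_mean_cst q #|st.2| 0); apply: le_binomial_mean => // j.
    exact: sqr_ge0.
  apply: (@le_trans _ _ (binomial_mean q #|st.2| (fun j => (j%:R - 0) ^+ 2))).
    apply: le_binomial_mean => // j; rewrite subr0 lerXn2r ?nnegrE ?lnmax1_ge0 //.
    exact: lnmax1_le_nat.
  apply: le_trans (binomial_mean_sqr_le prob01 _ _) _; rewrite subr0.
  have : (#|st.2|%:R * q) ^+ 2 <= D ^+ 2.
    by rewrite lerXn2r ?nnegrE // ltW.
  have : D <= D ^+ 2 by rewrite -{1}[D]expr1; exact: ler_weXn2l.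
  by lra.
have -> : u * (u * N) ^+ 2 = N * (u ^+ 3 * N) by ring.
rewrite ler_pM2l //; apply: le_trans (ler_wpM2l (ltW (scaleX_gt0 3)) N_ge).
have -> : u ^+ 3 * D ^+ 4 = u ^+ 3 * D * D * D ^+ 2 by ring.
rewrite ler_pM2r ?exprn_gt0 //; apply: (@le_trans _ _ (1 * D)).
  by rewrite mul1r; have := avg_deg_ge4; lra.
rewrite ler_pM2r //; apply: le_trans (scaleX_avg_deg _) => //.
by rewrite exprn_ege1 // ler1n.
Qed.

(** Per vertex, the variance is at most [2 m] and the squared bias at most [25 u^6 m^2]; the
    variance is small against [u^4 m^2] because [m >= u^4 D / 2]. *)
Lemma expect_deg_dev :
  EE (fun G => (typical_next (bfs G r k.+1))%:R * deg_dev G (bfs G r k.+1))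
    <= u * (u ^+ 3 * N * m ^+ 2).
Proof.
have m2 : 0 <= m ^+ 2 by exact: sqr_ge0.
apply: (@bfs_markov_le R T r q prob01 k.+1 typical_next (fun st G => deg_dev G st)).
- by apply: mulr_ge0 => //; apply: mulr_ge0 => //; apply: mulr_ge0.
- by move=> st sub G; rewrite /deg_dev (sum_deg_depends (fun j => (j%:R - m) ^+ 2) sub).
move=> st sub good; rewrite /deg_dev (expect_sum_deg q (fun j => (j%:R - m) ^+ 2) sub).
have -> : u * (u ^+ 3 * N * m ^+ 2) = N * (u ^+ 4 * m ^+ 2) by ring.
apply: ler_pM; rewrite ?ler0n //.
  rewrite -(binomial_mean_cst q #|st.2| 0); apply: le_binomial_mean => // j.
  exact: sqr_ge0.
apply: le_trans (binomial_mean_sqr_le prob01 _ _) _.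
have sqm : `|#|st.2|%:R * q - m| <= 5 * u ^+ 3 * m.
  have -> : #|st.2|%:R * q - m = (#|st.2|%:R - N * A) * q by rewrite /backdeg; ring.
  rewrite normrM (ger0_norm (ltW q_gt0)).
  have -> : 5 * u ^+ 3 * m = 5 * u ^+ 3 * (N * A) * q by rewrite /backdeg; ring.
  by rewrite ler_pM2r.
have sq2 : (#|st.2|%:R * q - m) ^+ 2 <= 25 * u ^+ 6 * m ^+ 2.
  have -> : 25 * u ^+ 6 * m ^+ 2 = (5 * u ^+ 3 * m) ^+ 2 by ring.
  rewrite -[leLHS]ger0_norm ?sqr_ge0 // normrX lerXn2r ?nnegrE //.
  exact: le_trans (normr_ge0 _) sqm.
have sq1 : #|st.2|%:R * q <= 2 * m.
  move: sqm; rewrite ler_distl => /andP[_ sqm]; apply: le_trans sqm _.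
  have := @scaleX_le 0 3 isT; rewrite expr0 /= => u3.
  by have := ler_wpM2r (ltW backdeg_gt0) u3; have := backdeg_gt0; lra.
have u6 := @scaleX_le 4 6 isT; rewrite /= in u6.
have h6 := ler_wpM2r m2 u6.
suff : 2 * m <= u ^+ 4 * m ^+ 2 / 2.
  have u42 : 0 <= u ^+ 4 * m ^+ 2 by apply: mulr_ge0.
  by move: sq2 sq1 h6; lra.
have -> : u ^+ 4 * m ^+ 2 / 2 = u ^+ 4 * m / 2 * m by ring.
rewrite ler_pM2r //.
have : u ^+ 4 * (u ^+ 4 * D / 2) <= u ^+ 4 * m by rewrite ler_pM2l ?scaleX_gt0 ?backdeg_ge.
have := @scaleX_avg_deg 8 isT; rewrite /= => h8.
have -> : u ^+ 4 * (u ^+ 4 * D / 2) = u ^+ 8 * D / 2 by ring.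
by move: h8; lra.
Qed.

Lemma expect_total_deg :
  EE (fun G => \sum_v (deg_in G [set~ v] v)%:R) <= u * (u * N * D ^+ 2).
Proof.
rewrite expect_sum; apply: (@le_trans _ _ (\sum_(v : T) D)).
  apply: ler_sum => v _; rewrite (expect_deg _ (fun j => j%:R)); last by rewrite !inE negbK.
  rewrite binomial_mean_id ler_wpM2r ?(ltW q_gt0) // ler_nat; exact: max_card.
rewrite sumr_const -[leLHS]mulr_natl.
have -> : u * (u * N * D ^+ 2) = N * (D * (u ^+ 2 * D)) by ring.
rewrite ler_pM2l // ler_peMr ?(ltW avg_deg_gt0) //.
by apply: le_trans (scaleX_avg_deg _) => //; rewrite exprn_ege1 // ler1n.
Qed.

Hypothesis lnD_le : u ^+ 2 * ln D <= 2.

Lemma sqr_le_norm (x y : R) : 0 <= y -> x ^+ 2 <= y ^+ 2 -> `|x| <= y.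
Proof. by move=> y0 h; rewrite -[y]ger0_norm // -ler_sqr ?nnegrE // !real_normK ?num_real. Qed.

Lemma card_setC_natr (B : {set T}) : #|~: B|%:R = N - #|B|%:R :> R.
Proof. by rewrite -(cardsC B) natrD addrAC subrr add0r. Qed.

(** The 5 in [typical_next] is 1 for the assumed fluctuation, 2 for [typical_reach] and 2 for the
    vertices lost to the ball. *)
Lemma typical_sphere_next G : typical_sphere (bfs G r k) ->
  (#|(bfs G r k.+1).2|%:R -
   #|~: (bfs G r k).1|%:R * reach q #|(bfs G r k).2|) ^+ 2 <=
    (u ^+ 3 * (N * A)) ^+ 2 ->
  typical_next (bfs G r k.+1).
Proof.
move=> typ; have NA0 : 0 < N * A by exact: mulr_gt0.
have e0 : 0 <= u ^+ 3 * (N * A) by apply: mulr_ge0; rewrite ?ltW.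
move=> /(sqr_le_norm e0); have := typical_reach typ.
case/andP: typ => _ bN; rewrite card_setC_natr /typical_next.
set s' := #|_|%:R; set b := #|_|%:R in bN *; set p := reach _ _.
rewrite !ler_distl => /andP[p1 p2] /andP[h1 h2].
have p0 : 0 <= p by exact: reach_ge0.
have b0 : 0 <= b by rewrite ler0n.
have Np1 := ler_wpM2l (ltW card_gt0R) p1; have Np2 := ler_wpM2l (ltW card_gt0R) p2.
have u3 := @scaleX_le 0 3 isT; rewrite expr0 /= in u3.
have p3 : p <= 2 * A.
  by apply: le_trans p2 _; have := ler_wpM2r (ltW covered_gt0) u3; have := covered_gt0; lra.
have bp : b * p <= u ^+ 3 * N * (2 * A) by exact: ler_pM.
have bp0 := mulr_ge0 b0 p0.
have e1 : u ^+ 3 * N * (2 * A) = 2 * (u ^+ 3 * (N * A)) by ring.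
have e2 : N * (A - 2 * u ^+ 3 * A) = N * A - 2 * (u ^+ 3 * (N * A)) by ring.
have e3 : N * (A + 2 * u ^+ 3 * A) = N * A + 2 * (u ^+ 3 * (N * A)) by ring.
rewrite e1 in bp; rewrite e2 in Np1; rewrite e3 in Np2; rewrite mulrBl in h1 h2.
by rewrite -!mulrA; apply/andP; split; lra.
Qed.

Lemma card_outside_next G : typical_sphere (bfs G r k) ->
  typical_next (bfs G r k.+1) ->
  `|#|~: (bfs G r k.+1).1|%:R - N * expR (- mu)| <= 6 * u ^+ 3 * N.
Proof.
move=> /andP[_ bN]; rewrite /typical_next card_setC_natr card_ballS natrD.
have b0 : 0 <= #|(bfs G r k).1|%:R :> R by [].
rewrite !ler_distl => /andP[h1 h2].
have -> : N * expR (- mu) = N - N * A by rewrite /covered; ring.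
have : u ^+ 3 * (N * A) <= u ^+ 3 * N.
  by apply: ler_wpM2l => //; rewrite ler_piMr // ltW.
by move: b0 bN h1 h2; rewrite -!mulrA; lra.
Qed.

Lemma binomial_mean_bound (s : nat) : s%:R * q <= D ->
  u ^+ 2 * binomial_mean q s f <= 3.
Proof.
move=> sD; have := binomial_lnmax1_le prob01 s avg_deg_ge1 => h.
have sD1 : s%:R * q / D <= 1 by rewrite ler_pdivrMr // mul1r.
have h1 := ler_wpM2l (scaleX_ge0 2) h; apply: le_trans h1 _.
have h2 := ler_wpM2l (scaleX_ge0 2) sD1.
by have := lnD_le; have := scaleX_le1 2; move: h2; rewrite mulrDr; lra.
Qed.

(** As [mu <= D], the error is at most [8 q D^2]; then [q D^3 <= 1] and [u D >= 1] conclude. *)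
Lemma poisson_error_le : poisson_error q mu <= 8 * u.
Proof.
have qD : q * D <= u ^+ 12.
  have D2 : 0 < D ^+ 2 by rewrite exprn_gt0.
  rewrite -(ler_pM2r D2) -mulrA -exprS; apply: le_trans prob_avg_deg3 _.
  have -> : u ^+ 12 * D ^+ 2 = u ^+ 12 * D * D by ring.
  by rewrite -[leLHS]mulr1 ler_pM.
have u12 : u ^+ 12 <= 1 / 100.
  have := @scaleX_le 0 12 isT; rewrite expr0 mul1r subn0 => h; apply: le_trans h _.
  have : (1 / 10) ^+ 10 <= 1 :> R by apply: exprn_ile1; lra.
  by rewrite (exprD _ 2 10) => h; nra.
have mu_D : mu <= D.
  by apply: le_trans spread_le _; rewrite ler_piMl ?scaleX_le1 // ltW.
have q2 : expR q - 1 <= 2 * q.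
  apply: expR_sub1_le; rewrite ltW //=; apply: (@le_trans _ _ (q * D)).
    by rewrite ler_peMr // ltW.
  by lra.
pose z := 2 * q + mu * (expR q - 1).
have e0 : 0 <= expR q - 1 by rewrite subr_ge0 -(expR0 R) ler_expR ltW.
have z0 : 0 <= z by rewrite addr_ge0 ?mulr_ge0 // ltW.
have zle : z <= 4 * (q * D).
  have : mu * (expR q - 1) <= D * (2 * q) by apply: ler_pM => //; exact: ltW.
  have : q <= q * D by rewrite ler_peMr // ltW.
  by rewrite /z; lra.
have := @expR_sub1_le R z; rewrite z0 => h.
have {}h : expR z - 1 <= 2 * z by apply: h; lra.
rewrite /poisson_error -/z.
apply: (@le_trans _ _ (D * (8 * (q * D)))).
  apply: ler_pM => //; [exact: ltW| |by lra].
  by rewrite subr_ge0 -(expR0 R) ler_expR.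
have -> : D * (8 * (q * D)) = 8 * (q * D ^+ 2) by ring.
rewrite ler_pM2l //; rewrite -(ler_pM2r avg_deg_gt0) -mulrA -exprSr.
apply: le_trans prob_avg_deg3 _; have := @scaleX_avg_deg 1 isT; rewrite expr1; apply: le_trans.
by rewrite exprn_ege1 ?ler1n.
Qed.

Lemma trunc_sphere :
  (Num.truncn (D ^+ k))%:R * q <= mu <= (Num.truncn (D ^+ k)).+1%:R * q.
Proof.
have /andP[s1 s2] := truncn_itv (ltW avg_degX_gt0).
by rewrite !ler_pM2r // s1 ltW.
Qed.

Lemma binomial_trunc_Psi0 :
  `|binomial_mean q (Num.truncn (D ^+ k)) f - Psi0 (expR (- mu))| <= 9 * u.
Proof.
apply: le_trans (binomial_Psi0 prob01 spread_gt0 trunc_sphere) _.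
have : u ^+ 24 <= u by rewrite exprS ler_piMr // scaleX_le1.
by have := poisson_error_le; have := prob_le; lra.
Qed.

(** The estimate goes through the binomial approximation, whose mean logarithm is bracketed by the
    tangent bounds with [c = mu], or [c = 1] for the upper bound when [mu <= 1]. *)
Lemma Psi0_log : `|Psi0 (expR (- mu)) - Num.max 0 (ln mu)| <= 2.
Proof.
have := binomial_trunc_Psi0; set s := Num.truncn _.
have /andP[s1 s2] := trunc_sphere; rewrite -/s in s1 s2.
have lo1 : 0 <= binomial_mean q s f.
  rewrite -(binomial_mean_cst q s 0); apply: le_binomial_mean => // j.
  exact: lnmax1_ge0.
have lo2 : ln mu - 1 <= binomial_mean q s f.
  apply: le_trans (binomial_lnmax1_ge prob01 s q_gt0 spread_gt0).
  suff : 2 * mu / (s.+1%:R * q) <= 2 by set z := _ / _; lra.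
  by rewrite ler_pdivrMr ?mulr_gt0 ?ltr0n // ler_pM2l.
have hi : binomial_mean q s f <= Num.max 0 (ln mu) + 1.
  have [mu1|mu1] := leP mu 1.
    have := binomial_lnmax1_le prob01 s (lexx 1); rewrite ln1 divr1 add0r.
    have : 0 <= Num.max 0 (ln mu) by rewrite le_max lexx.
    by move=> h1 h2; lra.
  apply: le_trans (binomial_lnmax1_le prob01 s (ltW mu1)) _.
  by rewrite lerD ?le_max ?lexx ?orbT // ler_pdivrMr // mul1r.
have : Num.max 0 (ln mu) - 1 <= binomial_mean q s f.
  by rewrite lerBlDr ge_max; apply/andP; split; lra.
by have := u_le; rewrite !ler_distl => h1 h2 /andP[h3 h4]; apply/andP; split; lra.
Qed.

(** The 14 is 1 for the fluctuation, 3 for the vertices of the ball, 1 for replacing the sphere size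
    by the integer part of [D ^+ k], and 9 for the Poisson limit. *)
Lemma layer_sum_first G : typical_sphere (bfs G r k) ->
  (layer_sum R G (bfs G r k) -
   #|~: (bfs G r k).1|%:R * binomial_mean q #|(bfs G r k).2| f) ^+ 2 <=
    (u * N) ^+ 2 ->
  `|layer_sum R G (bfs G r k) - N * Psi0 (expR (- mu))| <= 14 * (u * N).
Proof.
move=> /andP[typ bN] var; have uN : 0 <= u * N by apply: mulr_ge0 => //; exact: ltW.
have {var} := sqr_le_norm uN var; rewrite card_setC_natr.
set b := #|_|%:R in bN *; set x := D ^+ k in typ; set s := #|_| in typ *.
have u3 := @scaleX_le 1 3 isT; rewrite expr1 /= in u3.
have ux : 1 <= u ^+ 3 * x.
  apply: (@le_trans _ _ (u ^+ 3 * D ^+ 2)); last by rewrite ler_pM2l // avg_degX_ge2.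
  have -> : u ^+ 3 * D ^+ 2 = u ^+ 3 * D * D by ring.
  rewrite -[leLHS]mulr1 ler_pM //; apply: le_trans (scaleX_avg_deg _) => //.
  by rewrite exprn_ege1 ?ler1n.
have x0 : 0 < x by exact: avg_degX_gt0.
have sD : s%:R * q <= D.
  move: typ; rewrite ler_distl => /andP[_ typ].
  have := ler_wpM2r (ltW q_gt0) typ; rewrite mulrDl -mulrA -/mu => h.
  have h3 := @scaleX_le 0 3 isT; rewrite expr0 /= in h3.
  have := ler_wpM2r (ltW spread_gt0) h3.
  have h4 := @scaleX_le 0 4 isT; rewrite expr0 /= in h4.
  have := ler_wpM2r (ltW avg_deg_gt0) h4.
  by have := spread_le; have := avg_deg_gt0; lra.
have bs0 : 0 <= binomial_mean q s f.
  rewrite -(binomial_mean_cst q s 0); apply: le_binomial_mean => // j.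
  exact: lnmax1_ge0.
have bb : b * binomial_mean q s f <= 3 * (u * N).
  apply: le_trans (ler_wpM2r bs0 bN) _.
  have -> : u ^+ 3 * N * binomial_mean q s f =
    u * N * (u ^+ 2 * binomial_mean q s f) by ring.
  by rewrite [leRHS]mulrC ler_wpM2l // binomial_mean_bound.
have bb0 : 0 <= b * binomial_mean q s f by rewrite mulr_ge0.
pose s0 := Num.truncn x.
have /andP[s01 s02] : s0%:R <= x < s0.+1%:R by apply: truncn_itv; exact: ltW.
(* The two sizes differ by at most [2 u^3 x] and the denominator is at least [x / 2], so the
   difference is at most [8 u^3]. *)
have hd : `|binomial_mean q s f - binomial_mean q s0 f| <= u.
  apply: le_trans (binomial_lnmax1_dist prob01 s0 s q_gt0) _.
  rewrite ler_pdivrMr ?ltr0n //.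
  have ds : `|s%:R - s0%:R| <= 2 * (u ^+ 3 * x).
    move: typ; rewrite !ler_distl; move: s02; rewrite -natr1.
    by move=> s02 /andP[t1 t2]; apply/andP; split; lra.
  have mx : x / 2 <= (minn s0 s).+1%:R.
    have h3 := @scaleX_le 0 3 isT; rewrite expr0 /= in h3.
    have := ler_wpM2r (ltW x0) h3.
    rewrite /minn; case: ifP => _; first by lra.
    move: typ; rewrite ler_distl -[s.+1%:R]natr1 => /andP[t1 t2]; lra.
  have h1 := ler_wpM2l scale_ge0 mx.
  have h2 := ler_wpM2r (ltW x0) u3.
  have h3 := mulr_ge0 scale_ge0 (ltW x0).
  apply: le_trans h1; move: h2 ds; rewrite !mulrA => h2 ds.
  by move: h3; lra.
have hp := binomial_trunc_Psi0; rewrite -/x -/s0 in hp.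
move: hd hp; set b1 := binomial_mean _ _ _ in bb bb0 *; set b2 := binomial_mean _ _ _.
set h := Psi0 _; set L := layer_sum _ _ _; rewrite !ler_distl.
move=> /andP[d1 d2] /andP[p1 p2]; rewrite mulrBl => /andP[l1 l2].
have e1 : b1 - 10 * u <= h by lra.
have e2 : h <= b1 + 10 * u by lra.
have := ler_wpM2l (ltW card_gt0R) e1; have := ler_wpM2l (ltW card_gt0R) e2.
have -> : N * (b1 + 10 * u) = N * b1 + 10 * (u * N) by ring.
have -> : N * (b1 - 10 * u) = N * b1 - 10 * (u * N) by ring.
by move=> g1 g2; apply/andP; split; lra.
Qed.

(** For [x >= c / 2] the logarithm is Lipschitz in the relative deviation. Below [c / 2] the error
    can reach [ln c], but then [y >= 1/2] and the quadratic term pays; its sum is controlled by the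
    variance. *)
Lemma lnmax1_dev (x : nat) (c y : R) : 2 <= c -> y = `|x%:R - c| / c ->
  `|f x - ln c| <= 2 * y + 4 * ln c * y ^+ 2.
Proof.
move=> c2 yE; have c0 : 0 < c by lra.
have lc : 0 <= ln c by apply: ln_ge0; lra.
have y0 : 0 <= y by rewrite yE divr_ge0 // ltW.
have yc : `|x%:R - c| = y * c by rewrite yE divfK // lt0r_neq0.
have ly0 : 0 <= 4 * ln c * y ^+ 2 by rewrite !mulr_ge0 // sqr_ge0.
have [xlt|xge] := ltP (x%:R : R) (c / 2).
  have y2 : 1 / 2 <= y.
    move: yc; rewrite distrC ger0_norm; last by lra.
    by move=> yc; rewrite -(ler_pM2r c0) -yc; lra.
  have fx : f x <= ln c.
    rewrite /lnmax1; case: (x) xlt => [|x'] xlt; first by rewrite max0n ln1.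
    by rewrite (maxn_idPl _) // ler_ln ?posrE ?ltr0n //; lra.
  have f0 : 0 <= f x := lnmax1_ge0 R x.
  have : 1 / 4 <= y ^+ 2 by rewrite expr2; nra.
  move=> y4; have := ler_wpM2l lc y4; rewrite ler_distl => h.
  by apply/andP; split; move: h; rewrite -(mulrA 4); lra.
have x1 : (0 < x)%N by rewrite -(ltr0n R); lra.
rewrite /lnmax1 (maxn_idPl _) //.
have x0 : 0 < x%:R :> R by rewrite ltr0n.
have l1 := ln_le_subr1 (divr_gt0 x0 c0).
have l2 := ln_ge_1subrV (divr_gt0 x0 c0).
rewrite ln_div ?posrE // invf_div in l1 l2.
have l3 : x%:R / c - 1 <= y.
  rewrite yE -[X in _ - X](divff (lt0r_neq0 c0)) -mulrBl ler_pM2r ?invr_gt0 //.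
  exact: ler_norm.
have l4 : c / x%:R - 1 <= 2 * y.
  rewrite -[X in _ - X](divff (lt0r_neq0 x0)) -mulrBl ler_pdivrMr //.
  apply: (@le_trans _ _ (y * c)); first by rewrite -yc distrC ler_norm.
  by nra.
by rewrite ler_distl; apply/andP; split; lra.
Qed.

Lemma layer_sum_second G : deg_dev G (bfs G r k.+1) <= u ^+ 3 * N * m ^+ 2 ->
  `|layer_sum R G (bfs G r k.+1) - #|~: (bfs G r k.+1).1|%:R * ln m|
    <= 10 * (u * N).
Proof.
set st := bfs G r k.+1 => dev.
have uN : 0 <= u * N by apply: mulr_ge0 => //; exact: ltW.
have m2 : 0 < m ^+ 2 by rewrite exprn_gt0.
have c2 : 2 <= m.
  apply: le_trans backdeg_ge; have := @scaleX_avg_deg 4 isT; rewrite /= => h.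
  by apply: le_trans (_ : 10 ^+ 8 / 2 <= _); lra.
have lm : 0 <= ln m by apply: ln_ge0; lra.
have lmD : ln m <= ln D.
  by rewrite ler_ln ?posrE // /backdeg ler_piMr // ltW.
(* The linear term is split by [2 y <= u + y^2 / u], so only squared deviations remain to be
   summed. *)
pose K := u^-1 + 4 * ln m.
have K0 : 0 <= K by rewrite addr_ge0 ?invr_ge0 // mulr_ge0.
have term (v : T) : `|f (deg_in G st.2 v) - ln m| <=
    u + K / m ^+ 2 * ((deg_in G st.2 v)%:R - m) ^+ 2.
  have := lnmax1_dev c2 (erefl (`|(deg_in G st.2 v)%:R - m| / m)).
  set y := _ / m => h; apply: le_trans h _.
  have -> : K / m ^+ 2 * ((deg_in G st.2 v)%:R - m) ^+ 2 = K * y ^+ 2.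
    by rewrite /y expr_div_n real_normK ?num_real //; ring.
  have : 2 * y <= u + u^-1 * y ^+ 2.
    have -> : u + u^-1 * y ^+ 2 = 2 * y + u^-1 * (y - u) ^+ 2.
      by field; exact: lt0r_neq0.
    by rewrite lerDl mulr_ge0 ?invr_ge0 ?sqr_ge0.
  by rewrite /K mulrDl; lra.
have -> : layer_sum R G st - #|~: st.1|%:R * ln m =
    \sum_(v in ~: st.1) (f (deg_in G st.2 v) - ln m).
  by rewrite sumrB sumr_const mulr_natl.
apply: le_trans (ler_norm_sum _ _ _) _.
apply: le_trans (ler_sum _ (fun v _ => term v)) _.
rewrite big_split /= -mulr_sumr sumr_const -[X in X + _]mulr_natl -/(deg_dev G st).
have h1 : #|~: st.1|%:R * u <= u * N by rewrite mulrC ler_wpM2l.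
have h2 : K / m ^+ 2 * deg_dev G st <= K * (u ^+ 3 * N).
  rewrite -mulrA ler_wpM2l // mulrC ler_pdivrMr //.
have h3 : K * (u ^+ 3 * N) <= 9 * (u * N).
  have -> : K * (u ^+ 3 * N) = (u + 4 * (u ^+ 2 * ln m)) * (u * N).
    by rewrite /K; field; exact: lt0r_neq0.
  apply: ler_wpM2r => //; have := ler_wpM2l (scaleX_ge0 2) lmD.
  by have := lnD_le; have := u_le; lra.
by move: h1 h2 h3; lra.
Qed.

(** A vertex outside the ball of radius [k + 2] has no neighbour in the sphere of radius [k + 1], so
    it contributes [m ^+ 2] to [deg_dev]. *)
Lemma card_outside G : deg_dev G (bfs G r k.+1) <= u ^+ 3 * N * m ^+ 2 ->
  #|~: (bfs G r k.+2).1|%:R <= u ^+ 3 * N.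
Proof.
move=> h; have m2 : 0 < m ^+ 2 by rewrite exprn_gt0.
rewrite -(ler_pM2r m2); apply: le_trans h.
rewrite mulr_natl -sumr_const /deg_dev [leRHS]big_mkcond [leLHS]big_mkcond /=.
apply: ler_sum => v _; rewrite !finset.in_setC.
have [v2|v2] /= := boolP (v \in (bfs G r k.+2).1).
  by case: ifP => // _; exact: sqr_ge0.
have -> /= : v \notin (bfs G r k.+1).1.
  by apply: contra v2; apply: ball_sub; exact: leqnSn.
by rewrite (deg_in_eq0 v2) sub0r sqrrN.
Qed.

(** Linearizing the logarithm at [D^2] avoids individual degrees: [ln (D^2)] is paid only by the few
    vertices of the two sets, for [8 u N], and the total degree divided by [D^2] adds [u N]. *)
Lemma remainder_le G : #|(bfs G r k).1|%:R <= u ^+ 3 * N ->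
  #|~: (bfs G r k.+2).1|%:R <= u ^+ 3 * N ->
  \sum_v (deg_in G [set~ v] v)%:R <= u * N * D ^+ 2 ->
  \sum_(v in (bfs G r k).1 :|: ~: (bfs G r k.+2).1) f (deg_in G [set~ v] v)
    <= 9 * (u * N).
Proof.
set B := (bfs G r k).1; set C := ~: _ => hB hC hd.
have D2 : 1 <= D ^+ 2 by rewrite exprn_ege1.
have D2' : 0 < D ^+ 2 by lra.
apply: (@le_trans _ _ (\sum_(v in B :|: C) ln (D ^+ 2) +
    \sum_v (deg_in G [set~ v] v)%:R / D ^+ 2)).
  apply: (@le_trans _ _ (\sum_(v in B :|: C)
      (ln (D ^+ 2) + (deg_in G [set~ v] v)%:R / D ^+ 2))).
    by apply: ler_sum => v _; exact: lnmax1_le_lin.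
  rewrite big_split /= lerD2l [leRHS](bigID (mem (B :|: C))) /= lerDl.
  by apply: sumr_ge0 => v _; rewrite divr_ge0 // ltW.
rewrite -mulr_suml sumr_const -[X in X + _]mulr_natl lnXn // -[ln D *+ 2]mulr_natl.
have hd2 : (\sum_v (deg_in G [set~ v] v)%:R) / D ^+ 2 <= u * N.
  by rewrite ler_pdivrMr.
have lD : 0 <= ln D by exact: ln_ge0.
have hBC : #|B :|: C|%:R <= 2 * (u ^+ 3 * N).
  apply: (@le_trans _ _ (#|B|%:R + #|C|%:R)); last by lra.
  by rewrite -natrD ler_nat cardsU leq_subr.
have h1 : #|B :|: C|%:R * (2 * ln D) <= 2 * (u ^+ 3 * N) * (2 * ln D).
  by rewrite ler_wpM2r // mulr_ge0.
have h2 : 2 * (u ^+ 3 * N) * (2 * ln D) <= 8 * (u * N).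
  have -> : 2 * (u ^+ 3 * N) * (2 * ln D) = 4 * (u * N) * (u ^+ 2 * ln D) by ring.
  have -> : 8 * (u * N) = 4 * (u * N) * 2 by ring.
  by rewrite ler_pM2l // !mulr_gt0.
by move: h1 h2 hd2; lra.
Qed.

Definition spt_error G : R :=
  ln (num_spt G r)%:R - (N * Psi0 (expR (- mu)) + expR (- mu) * N * ln m).

(** The 45 is 14 and 10 for the two layers, 12 for the number of vertices left outside, and 9 for
    the remainder. *)
Lemma spt_error_le G : G \subset all_edges T ->
  typical_sphere (bfs G r k) ->
  (#|(bfs G r k.+1).2|%:R -
   #|~: (bfs G r k).1|%:R * reach q #|(bfs G r k).2|) ^+ 2 <=
    (u ^+ 3 * (N * A)) ^+ 2 ->
  (layer_sum R G (bfs G r k) -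
   #|~: (bfs G r k).1|%:R * binomial_mean q #|(bfs G r k).2| f) ^+ 2 <=
    (u * N) ^+ 2 ->
  deg_dev G (bfs G r k.+1) <= u ^+ 3 * N * m ^+ 2 ->
  \sum_v (deg_in G [set~ v] v)%:R <= u * N * D ^+ 2 ->
  `|spt_error G| <= 45 * (u * N).
Proof.
move=> GE typ h1 h2 h3 h4; have next := typical_sphere_next typ h1.
have out := card_outside_next typ next; have l1 := layer_sum_first typ h2.
have l2 := layer_sum_second h3.
have bN : #|(bfs G r k).1|%:R <= u ^+ 3 * N by case/andP: typ.
have rest := remainder_le bN (card_outside h3) h4.
have /andP[r0 r1] := @ln_num_spt_layers R T r G k GE.
have uN : 0 <= u * N by apply: mulr_ge0 => //; exact: ltW.
have m1 : 1 <= m.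
  apply: le_trans backdeg_ge; have := @scaleX_avg_deg 4 isT; rewrite /= => h.
  by apply: le_trans (_ : 10 ^+ 8 / 2 <= _); lra.
have lm : 0 <= ln m by exact: ln_ge0.
have lmD : ln m <= ln D by rewrite ler_ln ?posrE // /backdeg ler_piMr // ltW.
have l3 : `|#|~: (bfs G r k.+1).1|%:R * ln m - N * expR (- mu) * ln m| <= 12 * (u * N).
  rewrite -mulrBl normrM (ger0_norm lm).
  apply: le_trans (ler_wpM2r lm out) _.
  have -> : 6 * u ^+ 3 * N * ln m = 6 * (u * N) * (u ^+ 2 * ln m) by ring.
  have -> : 12 * (u * N) = 6 * (u * N) * 2 by ring.
  apply: ler_wpM2l; first by rewrite mulr_ge0.
  by apply: le_trans lnD_le; rewrite ler_pM2l.
rewrite /spt_error [expR _ * N]mulrC.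
move: r0 r1 rest l1 l2 l3; set L1 := layer_sum _ _ _; set L2 := layer_sum _ _ _.
set X := N * Psi0 _; set Y := N * _ * _; set Z := _ * ln m; set W := ln _.
set S := \sum_(v in _) _.
rewrite !ler_distl => r0 r1 rest /andP[a1 a2] /andP[b1 b2] /andP[c1 c2].
by apply/andP; split; lra.
Qed.

Theorem spt_error_prob :
  EE (fun G => (45 * (u * N) < `|spt_error G|)%R%:R) <= 13 * u.
Proof.
have e1 := expect_typical_sphere; have e2 := expect_typical_ball.
have e3 := expect_sphere_next; have e4 := expect_layer.
have e5 := expect_deg_dev; have e6 := expect_total_deg.
have NA0 : 0 < N * A by exact: mulr_gt0.
have mk (F : edge_set T -> R) (a c : R) : 0 < a ->
    (forall G, G \subset all_edges T -> 0 <= F G) -> EE F <= c * a ->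
    EE (fun G => (a < F G)%R%:R) <= c.
  move=> a0 F0 h; apply: le_trans (markov_expect prob01 a0 F0) _.
  by rewrite ler_pdivrMr.
have {}e1 := mk _ _ _ (mulr_gt0 (scaleX_gt0 3) avg_degX_gt0) (fun G _ => normr_ge0 _) e1.
have {}e2 := mk _ _ _ (mulr_gt0 (scaleX_gt0 3) card_gt0R) (fun G _ => ler0n _ _) e2.
have p3 : 0 < (u ^+ 3 * (N * A)) ^+ 2 by rewrite exprn_gt0 // mulr_gt0.
have {}e3 := mk _ _ _ p3 (fun G _ => mulr_ge0 (ler0n _ _) (sqr_ge0 _)) e3.
have p4 : 0 < (u * N) ^+ 2 by rewrite exprn_gt0 // mulr_gt0.
have {}e4 := mk _ _ _ p4 (fun G _ => mulr_ge0 (ler0n _ _) (sqr_ge0 _)) e4.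
have p5 : 0 < u ^+ 3 * N * m ^+ 2.
  by apply: mulr_gt0; [exact: mulr_gt0|exact: exprn_gt0].
have {}e5 := mk _ _ _ p5
  (fun G _ => mulr_ge0 (ler0n _ _) (sumr_ge0 _ (fun v _ => sqr_ge0 _))) e5.
have p6 : 0 < u * N * D ^+ 2.
  by apply: mulr_gt0; [exact: mulr_gt0|exact: exprn_gt0].
have {}e6 := mk _ _ _ p6 (fun G _ => sumr_ge0 _ (fun v _ => ler0n _ _)) e6.
have -> : 13 * u = 7 * u + 2 * u + u + u + u + u by ring.
apply: le_trans (lerD (lerD (lerD (lerD (lerD e1 e2) e3) e4) e5) e6).
rewrite -!expectD; apply: le_expect => // G GE.
(* A large error forces one of the six bad indicators to be 1. If all vanish, the first two make the
   sphere typical, which removes the indicator in front of the third and fourth; the third then does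
   the same for the fifth. *)
set i := (45 * _ < _); have [//|] := boolP i; last by rewrite !addr_ge0.
move=> iT; do !rewrite -natrD; rewrite ler1n lt0n; apply/negP => /eqP.
move=> /eqP; rewrite !addn_eq0 !eqb0 -!leNgt -!andbA => /and5P[g1 g2 g3 g4 /andP[g5 g6]].
have typ : typical_sphere (bfs G r k) by rewrite /typical_sphere g1.
rewrite typ !mul1r in g3 g4.
rewrite (typical_sphere_next typ g3) mul1r in g5.
by have := spt_error_le GE typ g3 g4 g5 g6; rewrite leNgt -/i iT.
Qed.

End Concentration.

(** * The hypotheses hold for all large [n] *)

Section Regime.
Local Open Scope ring_scope.
Local Open Scope classical_set_scope.
Variables (R : realType) (alpha : nat -> R).
Local Notation loglog n := (ln (ln n%:R) : R).
Local Notation q := (edge_prob alpha).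
Local Notation D := (mean_deg alpha).

Lemma limn_esup_lt (v : nat -> \bar R) (c : \bar R) : (limn_esup v < c)%E ->
  exists2 x, (x < c)%E & \forall n \near \oo, (v n <= x)%E.
Proof.
rewrite /limn_esup /limf_esup => /ereal_inf_lt[_ [V FV <-] ltc].
exists (ereal_sup (v @` V)) => //; apply: filterS FV => n Vn.
by apply: ereal_sup_ubound; exists n.
Qed.

Lemma limn_einf_gt (v : nat -> \bar R) (c : \bar R) : (c < limn_einf v)%E ->
  exists2 x, (c < x)%E & \forall n \near \oo, (x <= v n)%E.
Proof.
rewrite /limn_einf lteNr => /limn_esup_lt[x xc Vx].
exists (- x)%E; first by rewrite lteNr.
by apply: filterS Vx => n; rewrite leeNl.
Qed.

Definition scale (n : nat) : R := (Num.sqrt (loglog n))^-1.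
Local Notation u := scale.

Definition regime n k : Prop :=
  [/\ [/\ (1 < n)%N, 0 < q n, 0 < u n & u n <= 1 / 10],
      [/\ 1 <= u n ^+ 12 * D n, D n ^+ 4 <= n%:R & u n ^+ 2 * ln (D n) <= 2],
      D n ^+ k <= u n ^+ 4 * n%:R, u n ^+ 4 * n%:R <= D n ^+ k.+1
    & d_star alpha n = k.+1%:Z].

(** The threshold exceeds 1, so exponents at most 0 fail and the minimum over the integers is a
    positive natural number. Exponent [n] succeeds because [2 ^+ n >= n]. *)
Lemma d_starE n : 2 <= D n -> 1 < n%:R / loglog n ^+ 2 -> 1 <= loglog n ->
  exists k, [/\ D n ^+ k <= n%:R / loglog n ^+ 2,
    n%:R / loglog n ^+ 2 <= D n ^+ k.+1 & d_star alpha n = k.+1%:Z].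
Proof.
move=> D2; set x := n%:R / _ => x1 l1.
have D1 : 1 <= D n by lra.
have ex : exists d, x <= D n ^+ d.
  exists n; apply: (@le_trans _ _ n%:R).
    by rewrite ler_pdivrMr ?ler_peMr ?exprn_ege1 // exprn_gt0 //; lra.
  apply: (@le_trans _ _ (2 ^+ n)); last by rewrite lerXn2r ?nnegrE //; lra.
  by rewrite -natrX ler_nat ltnW // ltn_expl.
case: (ex_minnP ex) => -[|k] kx kmin.
  by rewrite expr0 in kx; lra.
exists k; split=> //.
  by rewrite leNgt; apply/negP => /ltW/kmin; rewrite ltnn.
have min d : x <= D n ^ d -> k.+1%:Z <= d.
  case: d => [d|d] xd; first by rewrite lez_nat; exact: kmin.
  have : D n ^ Negz d <= 1.
    by rewrite NegzE -exprnN invf_le1 ?exprn_gt0 ?exprn_ege1 //; lra.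
  by move=> /(le_trans xd); rewrite leNgt x1.
rewrite /d_star -/x; apply: xget_unique => [|y [y1 y2]]; first by split.
by apply/eqP; rewrite eq_le min // y2.
Qed.

(** With [l = loglog n] and [L = ln n], 100 gives [u <= 1/10]; 5040 is [7!], for
    [a exp(l) >= a l^7 / 7! >= l^6]; 120 is [5!], for [(b L)^4 <= L^5 / 5! <= n]. *)
Lemma regimeP n a b : 0 < a -> a <= alpha n <= b -> 100 <= loglog n ->
  5040 / a <= loglog n -> 120 * b ^+ 4 <= loglog n -> b <= loglog n ->
  exists k, regime n k.
Proof.
move=> a0 /andP[aa ab] l100 la lb bl; set l := loglog n in l100 la lb bl *.
have l0 : 0 < l by lra.
have L1 : 1 < ln n%:R :> R.
  by rewrite ltNge; apply/negP => /ln_le0; rewrite -/l; lra.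
have n1 : 1 < n%:R :> R.
  by rewrite ltNge; apply/negP => /ln_le0; lra.
have n0 : 0 < n%:R :> R by lra.
have LE : ln n%:R = expR l by rewrite lnK ?posrE //; lra.
have nE : n%:R = expR (ln n%:R) :> R by rewrite lnK ?posrE.
have DE : D n = alpha n * ln n%:R.
  by rewrite /mean_deg /edge_prob mulrC divfK // gt_eqF.
have al0 : 0 < alpha n by lra.
have b0 : 0 < b by lra.
have D0 : 0 < D n by rewrite DE mulr_gt0 //; lra.
have q0 : 0 < q n by rewrite divr_gt0 // mulr_gt0 //; lra.
have s0 : 0 < Num.sqrt l by rewrite sqrtr_gt0.
have u0 : 0 < u n by rewrite invr_gt0.
have u2 : u n ^+ 2 = l^-1 by rewrite exprVn sqr_sqrtr // ltW.
have u10 : u n <= 1 / 10.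
  rewrite -(@ler_pXn2r _ 2) ?nnegrE ?(ltW u0) // u2 -[leLHS]mul1r ler_pdivrMr //.
  by lra.
have l6D : l ^+ 6 <= D n.
  rewrite DE LE; apply: (@le_trans _ _ (a * expR l)); last first.
    by rewrite ler_wpM2r ?expR_ge0.
  have := @expR_ge1Dxn R l 6 (ltW l0); have -> : 7`!%:R = 5040 :> R by [].
  have l60 : 0 < l ^+ 6 by rewrite exprn_gt0.
  move: la; rewrite ler_pdivrMr // => la h.
  have := ler_wpM2l (ltW l60) la; rewrite [l ^+ 6 * (l * a)]mulrA -exprSr => h2.
  have := ler_wpM2l (ltW a0) h; rewrite mulrDr mulr1; lra.
have uD : 1 <= u n ^+ 12 * D n.
  by rewrite (exprM _ 2 6) u2 exprVn -ler_pdivrMl ?invr_gt0 ?exprn_gt0 // invrK mulr1.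
have D4n : D n ^+ 4 <= n%:R.
  apply: (@le_trans _ _ ((b * ln n%:R) ^+ 4)).
    rewrite lerXn2r ?nnegrE ?(ltW D0) ?mulr_ge0 ?(ltW b0) //; try lra.
    by rewrite DE ler_wpM2r //; lra.
  have L0 : 0 <= ln n%:R :> R by lra.
  rewrite exprMn [leRHS]nE; have := @expR_ge1Dxn R _ 4 L0; have -> : 5`!%:R = 120 :> R by [].
  have Ll : l <= ln n%:R by rewrite LE; have := expR_ge1Dx l; lra.
  have := ler_wpM2r (exprn_ge0 4 L0) (le_trans lb Ll); rewrite -exprS; lra.
have lD : u n ^+ 2 * ln (D n) <= 2.
  rewrite u2 ler_pdivrMl // DE lnM ?posrE //; last by lra.
  have : ln (alpha n) <= l by apply: le_trans (ln_le_subr1 al0) _; lra.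
  by rewrite -/l; lra.
have l21 : 1 <= l ^+ 6 by rewrite exprn_ege1 //; lra.
have u4 : u n ^+ 4 * n%:R = n%:R / l ^+ 2 by rewrite (exprM _ 2 2) u2 exprVn mulrC.
have l2 : 1 <= l ^+ 2 by rewrite exprn_ege1 //; lra.
have l20 : 0 < l ^+ 2 by lra.
have D2 : 2 <= D n.
  apply: le_trans l6D; apply: (@le_trans _ _ l); first by lra.
  by rewrite exprS ler_peMr ?exprn_ege1 //; lra.
have nl : 1 < n%:R / l ^+ 2.
  rewrite ltr_pdivlMr // mul1r; apply: lt_le_trans D4n.
  apply: (@le_lt_trans _ _ (D n)).
    by apply: le_trans l6D; apply: ler_weXn2l => //; lra.
  rewrite -[ltLHS]mulr1 exprS ltr_pM2l //; apply: lt_le_trans (_ : 2 ^+ 3 <= _).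
    by rewrite -natrX ltr1n.
  by rewrite lerXn2r ?nnegrE //; lra.
have l1 : 1 <= l by lra.
have [k [k1 k2 k3]] := d_starE D2 nl l1.
by exists k; split; rewrite ?u4 //; split=> //; rewrite -(ltr1n R).
Qed.

Lemma near_loglog (C : R) : \forall n \near \oo, C <= loglog n.
Proof.
exists (Num.truncn (expR (expR C))).+1 => // n /= nC.
have /andP[_ h] := truncn_itv (expR_ge0 (expR C)).
have {}h : expR (expR C) <= n%:R.
  by apply: le_trans (ltW h) _; rewrite ler_nat.
have n0 : 0 < n%:R :> R by apply: lt_le_trans h; exact: expR_gt0.
have h2 : expR C <= ln n%:R by rewrite -ler_expR lnK ?posrE.
have L0 : 0 < ln n%:R :> R by apply: lt_le_trans h2; exact: expR_gt0.
by rewrite -ler_expR [leRHS]lnK ?posrE.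
Qed.

Hypothesis liminf_gt0 : (0 < limn_einf (fun n => (alpha n)%:E))%E.
Hypothesis limsup_lt_pinfty : (limn_esup (fun n => (alpha n)%:E) < +oo)%E.

Lemma alpha_bounds : exists a b : R,
  0 < a /\ \forall n \near \oo, a <= alpha n <= b.
Proof.
have [x x0 nx] := limn_einf_gt liminf_gt0.
have [y y0 ny] := limn_esup_lt limsup_lt_pinfty.
exists (fine x), (fine y).
have xf : x \is a fin_num.
  rewrite gt0_fin_numE //; have [m _ /(_ _ (leqnn m)) /= h] := nx.
  exact: le_lt_trans h (ltry _).
have yf : y \is a fin_num.
  rewrite fin_num_abs lte_absl y0 andbT; have [m _ /(_ _ (leqnn m)) /= h] := ny.
  exact: lt_le_trans (ltNyr _) h.
split; first by rewrite fine_gt0 // x0 ltey_eq xf.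
near=> n; rewrite -!lee_fin !fineK //; apply/andP; split; near: n; [exact: nx|exact: ny].
Unshelve. all: by end_near. Qed.

Lemma near_regime : \forall n \near \oo, exists k, regime n k.
Proof.
have [a [b [a0 nab]]] := alpha_bounds.
near=> n; apply: (@regimeP n a b) => //; near: n => //; exact: near_loglog.
Unshelve. all: by end_near. Qed.

End Regime.

(** * Passage to the limit *)

Section Asymptotics.
Local Open Scope ring_scope.
Local Open Scope classical_set_scope.
Variables (R : realType) (alpha : nat -> R).
Hypothesis alpha_gt0 : forall n, 0 < alpha n.
Hypothesis liminf_gt0 : (0 < limn_einf (fun n => (alpha n)%:E))%E.
Hypothesis limsup_lt_pinfty : (limn_esup (fun n => (alpha n)%:E) < +oo)%E.
Local Notation loglog n := (ln (ln n%:R) : R).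
Local Notation q := (edge_prob alpha).
Local Notation D := (mean_deg alpha).
Local Notation u := (scale R).
Local Notation lam := (lambda alpha).

Lemma er_probE n (p : R) (P : pred (edge_set (vertex n))) :
  er_prob p P = expect (all_edges (vertex n)) p (fun G => (P G)%:R).
Proof.
rewrite /er_prob /expect big_mkcond /=; apply: eq_bigr => G _.
rewrite powersetE; case: (boolP (G \subset _)) => [sub|nsub] /=; last first.
  by rewrite mass_notsub ?mul0r.
by rewrite mass_sub //; case: (P G); rewrite ?mulr1 ?mulr0.
Qed.

Definition spt_dev n (G : edge_set (vertex n)) : R :=
  ln (num_spt G ord0)%:R - (n%:R * Psi0 (lam n)
    + lam n * n%:R * ln (alpha n * (1 - lam n) * ln n%:R)).

Section FixedSize.
Variables n k : nat.
Hypothesis reg : regime alpha n k.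
Local Notation mu := (@spread R (vertex n) (q n) k).

Lemma regime_card : #|vertex n|%:R = n%:R :> R.
Proof. by case: reg => -[n1 _ _ _] _ _ _ _; rewrite card_ord prednK // ltnW. Qed.

Lemma regime_natr_gt0 : 0 < n%:R :> R.
Proof. by case: reg => -[n1 _ _ _] _ _ _ _; rewrite ltr0n ltnW. Qed.

Lemma regime_mean_deg : #|vertex n|%:R * q n = D n.
Proof. by rewrite regime_card. Qed.

Lemma regime_mean_degE : D n = alpha n * ln n%:R.
Proof. by rewrite /mean_deg /edge_prob mulrC divfK // gt_eqF // regime_natr_gt0. Qed.

Lemma regime_mean_deg_gt0 : 0 < D n.
Proof.
by case: reg => -[_ q0 _ _] _ _ _ _; rewrite mulr_gt0 // regime_natr_gt0.
Qed.

Lemma regime_spread : mu = D n ^ d_star alpha n / n%:R.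
Proof.
rewrite /spread regime_mean_deg; case: reg => _ _ _ _ ->.
rewrite -exprnP exprS; set x := D n ^+ k; rewrite /mean_deg.
by rewrite [in RHS]mulrAC mulrC [n%:R * _]mulrC mulfK // gt_eqF // regime_natr_gt0.
Qed.

Lemma regime_lambda : lam n = expR (- mu).
Proof. by rewrite regime_spread. Qed.

Lemma spt_devE (G : edge_set (vertex n)) :
  spt_dev G = spt_error ord0 (q n) k G.
Proof.
rewrite /spt_dev /spt_error /backdeg /covered -regime_lambda regime_mean_deg regime_card.
by congr (_ - (_ + _ * ln _)); rewrite regime_mean_degE mulrAC.
Qed.

Lemma regime_prob : 0 <= q n <= 1.
Proof.
case: reg => -[_ q0 u0 u1] [uD D4 _] _ _ _; rewrite ltW //=.
have D0 := regime_mean_deg_gt0; have n0 := regime_natr_gt0.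
have D1 : 1 <= D n.
  apply: le_trans uD _; rewrite ler_piMl ?(ltW D0) //.
  by apply: exprn_ile1; [exact: ltW|lra].
rewrite -(ler_pM2l n0) mulr1; apply: le_trans D4.
by rewrite -[leLHS]expr1; exact: ler_weXn2l.
Qed.

Lemma spt_dev_prob :
  er_prob (q n) [pred G : edge_set (vertex n) | 45 * (u n * n%:R) < `|spt_dev G|]
    <= 13 * u n.
Proof.
have [[n1 q0 u0 u1] [h1 h2 h3] h4 h5 _] := reg.
have := @spt_error_prob R (vertex n) ord0 (q n) (u n) k q0 u0 u1.
rewrite regime_mean_deg regime_card => /(_ h1 h2 h4 h5 h3); rewrite er_probE.
apply: le_trans; apply: le_expect; first exact: regime_prob.
by move=> G _; rewrite /= spt_devE.
Qed.

(** By definition of [ell_star], [n] is [D n] to the power [ell_star n], so [D n ^ d_star / n] is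
    [D n] to the power [Delta]. *)
Lemma regime_ln_spread : ln mu = ln (D n) * Delta alpha n.
Proof.
rewrite regime_spread; case: reg => -[n1 q0 u0 u1] [uD D4 _] _ _ kE.
have D0 := regime_mean_deg_gt0; have n0 := regime_natr_gt0.
have D1 : 1 < D n.
  rewrite ltNge; apply/negP => D1; move: uD; rewrite leNgt => /negP; apply.
  apply: (@le_lt_trans _ _ (u n ^+ 12)).
    by rewrite ler_piMr // exprn_ge0 // ltW.
  by apply: exprn_ilt1; rewrite ?ltW //; lra.
have lD : ln (D n) != 0 by rewrite gt_eqF // ln_gt0.
rewrite /Delta kE -exprnP ln_div ?posrE ?exprn_gt0 // lnXn // /ell_star mulrBr.
by rewrite mulrCA divff // mulr1 -pmulrn mulr_natr.
Qed.

Lemma regime_Psi0 : `|Psi0 (lam n) - Num.max 0 (ln (D n) * Delta alpha n)| <= 2.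
Proof.
have [[n1 q0 u0 u1] [h1 h2 h3] h4 h5 _] := reg.
rewrite regime_lambda -regime_ln_spread.
by apply: (@Psi0_log R (vertex n) ord0 (q n) (u n) k);
  rewrite ?regime_mean_deg ?regime_card.
Qed.

(** The difference is [ln (1 - lam n)], and [1 - lam n] is at least half of [(loglog n)^-2]; this is
    negligible against [loglog n]. *)
Lemma regime_ln_backdeg : 1 <= loglog n ->
  `|ln (alpha n * (1 - lam n) * ln n%:R) - ln (D n)| <= 2 * ln (loglog n) + 1.
Proof.
have [[n1 q0 u0 u1] _ _ h5 kE] := reg; set l := loglog n => l1.
have l0 : 0 < l by lra.
have u4 : u n ^+ 4 = (l ^+ 2)^-1.
  by rewrite /scale exprVn (exprM _ 2 2) sqr_sqrtr // ltW.
have u40 : 0 < u n ^+ 4 by rewrite exprn_gt0.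
have D0 := regime_mean_deg_gt0; have n0 := regime_natr_gt0.
have lo : u n ^+ 4 / 2 <= 1 - lam n.
  apply: (@le_trans _ _ (1 - expR (- u n ^+ 4))).
    apply: onem_expR_ge; rewrite ltW //=; apply: exprn_ile1; first exact: ltW.
    by lra.
  by rewrite lerD2l lerN2 ler_expR lerN2 kE ler_pdivlMr.
have lo0 : 0 < 1 - lam n by apply: lt_le_trans lo; lra.
have -> : alpha n * (1 - lam n) * ln n%:R = D n * (1 - lam n).
  by rewrite regime_mean_degE mulrAC.
rewrite lnM ?posrE // addrAC subrr add0r ler0_norm; last first.
  by apply: ln_le0; have := expR_ge0 (- (D n ^ d_star alpha n / n%:R)); rewrite /lambda; lra.
have : ln (u n ^+ 4 / 2) <= ln (1 - lam n) by rewrite ler_ln ?posrE //; lra.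
rewrite ln_div ?posrE // u4 lnV ?posrE ?exprn_gt0 // lnXn // -[ln l *+ 2]mulr_natl.
by have := @ln_le_subr1 R 2; rewrite ltr0n => /(_ isT); lra.
Qed.

End FixedSize.

Lemma cvg_scale : u n @[n --> \oo] --> 0.
Proof.
apply/cvgrPdist_le => e e0; near=> n.
have l : e^-1 ^+ 2 <= loglog n by near: n; exact: near_loglog.
rewrite sub0r normrN ger0_norm ?invr_ge0 ?sqrtr_ge0 // /scale.
rewrite -[e]invrK lef_pV2 ?posrE ?invr_gt0 ?sqrtr_gt0 //; last first.
  by apply: lt_le_trans l; rewrite exprn_gt0 // invr_gt0.
by rewrite -[leLHS]ger0_norm ?invr_ge0 ?(ltW e0) // -sqrtr_sqr ler_wsqrtr.
Unshelve. all: by end_near. Qed.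

Lemma cvg_le_scale (g : nat -> R) c C :
  (\forall n \near \oo, `|g n - c| <= C * u n) -> g n @[n --> \oo] --> c.
Proof.
move=> h; apply/cvgrPdist_le => e e0.
have Cu : C * u n @[n --> \oo] --> 0.
  by rewrite -(mulr0 C); apply: cvgM; [exact: cvg_cst|exact: cvg_scale].
have /cvgrPdist_le/(_ _ e0) Cu' := Cu.
near=> n; rewrite distrC; apply: (@le_trans _ _ (C * u n)); first by near: n.
have : `|0 - C * u n| <= e by near: n.
by rewrite sub0r normrN; apply: le_trans; exact: ler_norm.
Unshelve. all: by end_near. Qed.

(** All randomness is confined to one exceptional event of probability at most [13 u]; off that
    event a deterministic estimate is enough. *)
Lemma er_cvg_dev (Z : forall n, edge_set (vertex n) -> R) (l : R) :
  (forall e, 0 < e -> \forall n \near \oo, forall G : edge_set (vertex n),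
     `|spt_dev G| <= 45 * (u n * n%:R) -> `|Z n G - l| <= e) ->
  er_cvg_in_prob q Z l.
Proof.
move=> h e e0; apply: (@cvg_le_scale _ _ 13); have he := h e e0.
near=> n; have [k reg] : exists k, regime alpha n k.
  by near: n; exact: near_regime.
rewrite subr0 ger0_norm; last first.
  by rewrite er_probE; apply: expect_ge0 => //; exact: regime_prob reg.
apply: le_trans (spt_dev_prob reg); rewrite !er_probE.
apply: le_expect; first exact: regime_prob reg.
move=> G _ /=; case: ltP => // eZ; case: ltP => // dev.
have : `|Z n G - l| <= e by move: G dev {eZ}; near: n.
by rewrite leNgt eZ.
Unshelve. all: by end_near. Qed.

Lemma spt_dev_little_op : er_little_op_n q spt_dev.
Proof.
apply: er_cvg_dev => e e0.
have Cu : 45 * u n @[n --> \oo] --> 0.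
  by rewrite -(mulr0 45); apply: cvgM; [exact: cvg_cst|exact: cvg_scale].
have /cvgrPdist_le/(_ _ e0) Cu' := Cu.
near=> n => G dev; rewrite subr0.
have [k reg] : exists k, regime alpha n k by near: n; exact: near_regime.
have n0 := regime_natr_gt0 reg.
rewrite normrM normfV (ger0_norm (ltW n0)) ler_pdivrMr //; apply: le_trans dev _.
rewrite mulrA ler_pM2r //; have : `|0 - 45 * u n| <= e by near: n.
by rewrite sub0r normrN; apply: le_trans; exact: ler_norm.
Unshelve. all: by end_near. Qed.

Lemma loglog_inv_le n : 1 <= loglog n ->
  [/\ 0 < u n, (loglog n)^-1 <= u n & ln (loglog n) / loglog n <= 2 * u n].
Proof.
rewrite /scale; set l := loglog n => l1; have l0 : 0 < l by lra.
set s := Num.sqrt l; have s0 : 0 < s by rewrite sqrtr_gt0.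
have s2 : l = s ^+ 2 by rewrite sqr_sqrtr // ltW.
have s1 : 1 <= s by rewrite -(@ler_pXn2r _ 2) ?nnegrE ?(ltW s0) // expr1n -s2.
split; first by rewrite invr_gt0.
  by rewrite lef_pV2 ?posrE // s2 expr2 ler_peMr // ltW.
rewrite s2 lnXn // -[ln s *+ 2]mulr_natl ler_pdivrMr ?exprn_gt0 //.
have -> : 2 * s^-1 * s ^+ 2 = 2 * s by field; exact: lt0r_neq0.
by rewrite ler_pM2l //; have := ln_le_subr1 s0; lra.
Qed.

Lemma cvg_ln_mean_deg : ln (D n) / loglog n @[n --> \oo] --> (1 : R).
Proof.
have [a [b [a0 nab]]] := alpha_bounds liminf_gt0 limsup_lt_pinfty.
apply: (@cvg_le_scale _ _ (`|ln a| + `|ln b|)); near=> n.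
have /andP[aa ab] : a <= alpha n <= b by near: n.
have l1 : 1 <= loglog n by near: n; exact: near_loglog.
have [k reg] : exists k, regime alpha n k by near: n; exact: near_regime.
have al0 := alpha_gt0 n.
have L0 : 0 < ln n%:R :> R.
  by rewrite ltNge; apply/negP => h; move: l1; rewrite ln0 // ler10.
have [u0 lu _] := loglog_inv_le l1.
rewrite (regime_mean_degE reg) lnM ?posrE // mulrDl divff ?addrK; last first.
  by rewrite gt_eqF //; lra.
rewrite normrM; apply: ler_pM => //.
  have h1 : ln a <= ln (alpha n) by rewrite ler_ln ?posrE.
  have h2 : ln (alpha n) <= ln b by rewrite ler_ln ?posrE //; lra.
  have := ler_norm (ln b); have := ler_norm (- ln a); rewrite normrN.
  have := normr_ge0 (ln a); have := normr_ge0 (ln b).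
  by move=> *; rewrite ler_norml; apply/andP; split; lra.
by rewrite ger0_norm // invr_ge0; lra.
Unshelve. all: by end_near. Qed.

Definition spt_rate n : R :=
  (Psi0 (lam n) + lam n * ln (alpha n * (1 - lam n) * ln n%:R)) / loglog n.

Lemma lambda_01 n : 0 < D n -> 0 <= lam n <= 1.
Proof.
move=> D0; rewrite expR_ge0 expR_le1 oppr_le0 divr_ge0 //.
exact/ltW/exprz_gt0.
Qed.

Lemma cvg_spt_rate (l Del : R) : 0 <= Del ->
  lam n @[n --> \oo] --> l -> Delta alpha n @[n --> \oo] --> Del ->
  spt_rate n @[n --> \oo] --> l + Del.
Proof.
move=> Del0 cl cD; pose g n := ln (D n) / loglog n.
have cg : g n @[n --> \oo] --> (1 : R) := cvg_ln_mean_deg.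
pose x n := g n * Delta alpha n.
(* The positive part of [x n] is written with an absolute value, so that its limit follows by
   continuity. *)
pose w n := lam n * g n + (x n + `|x n|) / 2.
have cx : x n @[n --> \oo] --> Del by rewrite -[Del]mul1r; exact: cvgM.
have cw : w n @[n --> \oo] --> l + Del.
  have -> : l + Del = l * 1 + (Del + `|Del|) / 2 by rewrite ger0_norm //; field.
  apply: cvgD; first exact: cvgM.
  by apply: cvgMl; apply: cvgD => //; exact: cvg_norm.
have cd : spt_rate n - w n @[n --> \oo] --> 0.
  (* The 7 is 2 from [regime_Psi0] and, from [regime_ln_backdeg], 4 for the iterated logarithm and 1
     for the constant. *)
  apply: (@cvg_le_scale _ _ 7); near=> n; rewrite subr0.
  have l1 : 1 <= loglog n by near: n; exact: near_loglog.
  have [k reg] : exists k, regime alpha n k by near: n; exact: near_regime.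
  have [u0 lu lnl] := loglog_inv_le l1.
  have li0 : 0 < (loglog n)^-1 by rewrite invr_gt0; lra.
  have h1 := ler_wpM2r (ltW li0) (regime_Psi0 reg).
  have h2 := ler_wpM2r (ltW li0) (regime_ln_backdeg reg l1).
  have /andP[lam0 lam1] := lambda_01 (regime_mean_deg_gt0 reg).
  rewrite -[X in `|_| * X](gtr0_norm li0) -normrM in h1.
  rewrite -[X in `|_| * X](gtr0_norm li0) -normrM in h2.
  have -> : spt_rate n - w n =
      (Psi0 (lam n) - Num.max 0 (ln (D n) * Delta alpha n)) / loglog n +
      lam n * ((ln (alpha n * (1 - lam n) * ln n%:R) - ln (D n)) / loglog n).
    have -> : w n = lam n * (ln (D n) / loglog n) +
        Num.max 0 (ln (D n) * Delta alpha n) / loglog n.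
      rewrite /w /x /g; congr (_ + _); rewrite maxr_absE add0r sub0r normrN.
      rewrite [ln (D n) / _ * _]mulrAC normrM (gtr0_norm li0).
      by rewrite -mulrDl mulrAC.
    by rewrite /spt_rate; ring.
  apply: le_trans (ler_normD _ _) _; rewrite [X in _ + X]normrM (ger0_norm lam0).
  have h3 := ler_piMl (normr_ge0
    ((ln (alpha n * (1 - lam n) * ln n%:R) - ln (D n)) / loglog n)) lam1.
  move: h1 h2 h3; rewrite (mulrDl (2 * _)) -(mulrA 2 (ln (loglog n))) mul1r.
  by move=> h1 h2 h3; lra.
have -> : spt_rate = (fun n => (spt_rate n - w n) + w n).
  by apply/funext => n; rewrite subrK.
by rewrite -[l + Del]add0r; exact: cvgD.
Unshelve. all: by end_near. Qed.

(** Eventually [mu >= ln mu >= (Del / 2) loglog n], and [exp(- mu) <= 1 / mu]. *)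
Lemma lambda_cvg0 (Del : R) : 0 < Del ->
  Delta alpha n @[n --> \oo] --> Del -> lam n @[n --> \oo] --> 0.
Proof.
move=> Del0 cD.
have cg := cvg_ln_mean_deg.
have cx : ln (D n) / loglog n * Delta alpha n @[n --> \oo] --> Del.
  by rewrite -[Del]mul1r; exact: cvgM.
have half : Del / 2 < Del by lra.
have near_half := cvgr_gt Del cx _ half.
apply: (@cvg_le_scale _ _ (2 / Del)); near=> n; rewrite subr0.
have l1 : 1 <= loglog n by near: n; exact: near_loglog.
have [k reg] : exists k, regime alpha n k by near: n; exact: near_regime.
have [u0 lu _] := loglog_inv_le l1.
rewrite (regime_lambda reg) ger0_norm ?expR_ge0 //.
have h : Del / 2 < ln (D n) / loglog n * Delta alpha n by near: n; exact: near_half.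
have l0 : 0 < loglog n by lra.
have mu_ge : Del / 2 * loglog n <= spread (vertex n) (q n) k.
  have := h; rewrite mulrAC -(regime_ln_spread reg) ltr_pdivlMr // => h'.
  apply: le_trans (ltW h') _; have [s0|s0] := ltP 0 (spread (vertex n) (q n) k).
    by apply: le_trans (ln_le_subr1 s0) _; rewrite gerBl.
  (* A nonpositive [mu] is excluded because [ln] takes the default value 0 there, against a positive
     lower bound. *)
  have := mulr_gt0 (divr_gt0 Del0 (ltr0Sn R 1)) l0.
  by move=> pos; have := lt_trans pos h'; rewrite ln0 // ltxx.
have pos : 0 < Del / 2 * loglog n by rewrite mulr_gt0 // divr_gt0.
rewrite expRN.
apply: (@le_trans _ _ (Del / 2 * loglog n)^-1).
  rewrite lef_pV2 ?posrE ?expR_gt0 //; apply: le_trans mu_ge _.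
  by apply: le_trans (expR_ge1Dx _); rewrite lerDr.
by rewrite invfM invf_div ler_pM2l // divr_gt0.
Unshelve. all: by end_near. Qed.

End Asymptotics.

Local Open Scope classical_set_scope.
Local Open Scope ring_scope.

Theorem theorem6p4 (R : realType) (alpha : nat -> R)
    (alpha_gt0 : forall n : nat, 0 < alpha n)
    (liminf_gt0 : (0 < limn_einf (fun n => (alpha n)%:E))%E)
    (limsup_lt_pinfty : (limn_esup (fun n => (alpha n)%:E) < +oo)%E) :
  er_little_op_n (edge_prob alpha)
    (fun n (G : edge_set (vertex n)) =>
       ln (num_spt G ord0)%:R
       - (n%:R * Psi0 (lambda alpha n)
          + lambda alpha n * n%:R
            * ln (alpha n * (1 - lambda alpha n) * ln n%:R)))
  /\
  (forall lam Del : R,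
     0 <= lam <= 1 -> 0 <= Del <= 1 ->
     lambda alpha n @[n --> \oo] --> lam ->
     Delta alpha n @[n --> \oo] --> Del ->
     er_cvg_in_prob (edge_prob alpha)
       (fun n (G : edge_set (vertex n)) =>
          ln (num_spt G ord0)%:R / (n%:R * ln (ln n%:R)))
       (lam + Del)
     /\ lam + Del = if 0 < Del then Del else lam).
Proof.
split; first exact: spt_dev_little_op.
move=> lam Del _ /andP[Del0 _] clam cDel; split; last first.
  case: ltP => Del_gt0; last first.
    have -> : Del = 0 by apply/eqP; rewrite eq_le Del_gt0.
    by rewrite addr0.
  have c0 := lambda_cvg0 alpha_gt0 liminf_gt0 limsup_lt_pinfty Del_gt0 cDel.
  by rewrite (cvg_unique _ clam c0) ?add0r //; exact: norm_hausdorff.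
have crate := cvg_spt_rate alpha_gt0 liminf_gt0 limsup_lt_pinfty Del0 clam cDel.
apply: er_cvg_dev => // e e0; have e2 : 0 < e / 2 by lra.
have /cvgrPdist_le/(_ _ e2) near_rate := crate.
have Cu : 45 * scale R n @[n --> \oo] --> 0.
  by rewrite -(mulr0 45); apply: cvgM; [exact: cvg_cst|exact: cvg_scale].
have /cvgrPdist_le/(_ _ e2) near_scale := Cu.
near=> n => G dev.
have [k reg] : exists k, regime alpha n k by near: n; exact: near_regime.
have n0 := regime_natr_gt0 reg.
have l1 : 1 <= ln (ln n%:R) :> R by near: n; exact: near_loglog.
have l0 : 0 < ln (ln n%:R) :> R by lra.
have h1 : `|lam + Del - spt_rate alpha n| <= e / 2 by near: n.
have h2 : 45 * scale R n <= e / 2.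
  have : `|0 - 45 * scale R n| <= e / 2 by near: n.
  by rewrite sub0r normrN; apply: le_trans; exact: ler_norm.
have E : ln (num_spt G ord0)%:R / (n%:R * ln (ln n%:R)) - spt_rate alpha n =
    spt_dev alpha G / (n%:R * ln (ln n%:R)).
  rewrite /spt_dev /spt_rate; field.
  by rewrite !lt0r_neq0.
have h3 : `|spt_dev alpha G / (n%:R * ln (ln n%:R))| <= e / 2.
  rewrite normrM normfV (gtr0_norm (mulr_gt0 n0 l0)) ler_pdivrMr ?mulr_gt0 //.
  apply: le_trans dev _; rewrite [leRHS]mulrCA mulrA mulrC.
  apply: ler_wpM2l; first exact: ltW.
  apply: le_trans h2 _; rewrite ler_peMr //; exact: ltW.
rewrite -E in h3; rewrite distrC in h1.
rewrite -(subrKA (spt_rate alpha n)); apply: le_trans (ler_normD _ _) _; lra.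
Unshelve. all: by end_near. Qed.
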